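(* Let $d=1$, i.e. $G/P=\mathrm{Gr}(k,n)$. For all $\lambda,\mu\in\Gamma$ the deformed motivic Segre classes satisfy $$\bigl(q^{\ell(\lambda)}S_\lambda\bigr)\bigl(q^{\ell(\mu)}S_\mu\bigr)=\sum_{\nu\in\Gamma}\Bigl(\sum_{P}\mathrm{fug}(P)\Bigr)\,q^{\ell(\nu)}S_\nu ,$$ where the inner sum runs over all Knutson–Tao puzzles $P$ with north-west side $\lambda$, north-east side $\mu$ and bottom side $\nu$.
   Context: **Combinatorics.** $1\le k\le n-1$. $\Gamma$ is the set of words of length $n$ with $k$ letters $1$ and $n-k$ letters $0$; $w_0=1^k0^{n-k}$. $\Sigma=\{y_i-y_j:i\neq j\}$, $\alpha_i=y_i-y_{i+1}$, $\Sigma_\Theta^+=\{y_i-y_j:i\le k<j\}$. $W=S_n$ acts on weights by $w(y_i)=y_{w(i)}$ and on $\Gamma$ by $(w\lambda)_{w(i)}=\lambda_i$; $r_i=(i,i+1)$. $\ell(\lambda)=\#\{i<j:\lambda_i>\lambda_j\}$; $w_\lambda$ is the minimal length permutation with $\lambda=w_\lambda\cdot w_0$. **Deformed motivic Segre classes.** $Q=Q(\beta,q)=q^2+\beta-q^2\beta$. Let $B=\mathbb Z[e^{\pm y_1},\dots,e^{\pm y_n},q^{\pm1},\beta^{\pm1}]$ ($=K_{\widehat T}(\mathrm{pt})[\beta,\beta^{-1}]$), with $W$ acting on the $e^{y_i}$ by permuting indices and fixing $q,\beta$, and let $B^{\mathrm{loc}}$ be its localization at $\{Q-q^2e^\alpha\}_{\alpha\in\Sigma}$.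 Define operators on $\bigoplus_{\mu\in\Gamma}\mathrm{Frac}(B)$ by $$(\partial_if)|_\mu=\frac{\beta(1-q^2)}{1-e^{-\alpha_i}}f|_\mu+\frac{Q-q^2e^{\alpha_i}}{1-e^{\alpha_i}}r_i(f|_{r_i\mu}).$$ They satisfy the braid relations, giving $\partial_w$ for $w\in W$. $S_{w_0}|_{w_0}=\prod_{\alpha\in\Sigma_\Theta^+}\frac{1-e^{-\alpha}}{Q-q^2e^{-\alpha}}$, $S_{w_0}|_\mu=0$ for $\mu\ne w_0$, and $S_\lambda:=\partial_{w_\lambda}(S_{w_0})\in\bigoplus_{\mu\in\Gamma}B^{\mathrm{loc}}$. Products are componentwise. **Puzzles.** A puzzle is an upward triangle of side $n$ tiled by unit rhombi at positions $(i,j)$, $1\le i<j\le n$, and $n$ upward unit triangles along the bottom row. The rhombus $(i,j)$ lies at the intersection of the south-west-to-north-east strip above the $i$-th bottom edge and the north-west-to-south-east strip above the $j$-th bottom edge (edges counted from the left). All edges carry labels in $\{0,1,10\}$; the north-west side reads $\lambda$ from bottom to top, the north-east side reads $\mu$ from top to bottom, and the bottom side reads $\nu$ from left to right. Equivalently, a puzzle is a choice of labels $g_{j,i}$ ($0\le i\le j-1$) and $h_{i,j}$ ($i\le j\le n$) with $g_{j,0}=\lambda_j$, $h_{i,n}=\mu_i$, where the rhombus $(i,j)$ has NW edge $g_{j,i-1}$, NE edge $h_{i,j}$, SW edge $h_{i,j-1}$, SE edge $g_{j,i}$, and the $i$-th bottom triangle has (NW, bottom, NE) edges $(g_{i,i-1},\nu_i,h_{i,i})$.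 The allowed triangles are $(0,0,0),(1,1,1),(0,1,10),(10,0,1)$, each of fugacity $1$. The allowed rhombi, written (NW,NE)$\to$(SW,SE), have the following fugacities, where for the rhombus $(i,j)$ one sets $z=e^{y_j-y_i}$, $a=\beta(1-q^2)$, $E=Q-q^2z$: - $1$: $(0,0)\to(0,0)$, $(1,1)\to(1,1)$, $(1,0)\to(0,1)$, $(10,1)\to(1,10)$, $(0,10)\to(10,0)$; - $Q$: $(10,10)\to(10,10)$; - $\frac aE$: $(0,0)\to(1,10)$, $(1,1)\to(10,0)$; - $\frac{az}E$: $(0,10)\to(1,1)$, $(10,1)\to(0,0)$; - $\frac{q(1-z)}E$: $(0,1)\to(1,0)$; - $\frac{qQ(1-z)}E$: $(10,0)\to(0,10)$, $(1,10)\to(10,1)$; - $-\frac{qa}E$: $(1,0)\to(10,10)$; - $-\frac{aQz}{qE}$: $(10,10)\to(0,1)$. $\mathrm{fug}(P)$ is the product of the fugacities of all tiles of $P$. *)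

(* Defs.v *)
(* Indices are 0-based throughout: y_1, ..., y_n become y_0, ..., y_{n-1},
   indexed by 'I_n. *)
From HB Require Import structures.
From mathcomp Require Import all_boot all_order all_algebra all_fingroup.
From mathcomp Require Import fraction generic_quotient mpoly zify.
Set Implicit Arguments.
Unset Strict Implicit.
Unset Printing Implicit Defensive.
Import GRing.Theory.
Local Open Scope ring_scope.

Definition word (n : nat) := {ffun 'I_n -> bool}.

(* W acts on the left: (w lambda)_{w(i)} = lambda_i. *)
Definition actw n (w : 'S_n) (l : word n) : word n :=
  [ffun i => l ((w^-1)%g i)].

Definition Gamma (n k : nat) := {l : word n | #|[set i | l i]| == k}.

Lemma actw_subproof n k (w : 'S_n) (l : Gamma n k) :
  #|[set i | actw w (val l) i]| == k.
Proof.
have -> : [set i | actw w (val l) i] = w @: [set i | val l i].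
  apply/setP=> i; rewrite !inE ffunE; apply/idP/imsetP.
    by move=> h; exists ((w^-1)%g i); rewrite ?inE ?permKV.
  by case=> x; rewrite inE => h ->; rewrite permK.
by rewrite card_imset; [exact: valP l | exact: perm_inj].
Qed.

Definition actG n k (w : 'S_n) (l : Gamma n k) : Gamma n k :=
  exist _ (actw w (val l)) (actw_subproof w l).

Definition w0 (n k : nat) : word n := [ffun i : 'I_n => (i < k)%N].

Definition ell n (l : word n) : nat :=
  #|[set p : 'I_n * 'I_n | (p.1 < p.2)%N && (l p.2 < l p.1)%N]|.

Lemma rlo_subproof n (i : 'I_n.-1) : (i < n)%N.
Proof. by have := ltn_ord i; lia. Qed.

Lemma rhi_subproof n (i : 'I_n.-1) : (i.+1 < n)%N.
Proof. by have := ltn_ord i; lia. Qed.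

Definition rlo n (i : 'I_n.-1) : 'I_n := Ordinal (rlo_subproof i).
Definition rhi n (i : 'I_n.-1) : 'I_n := Ordinal (rhi_subproof i).

Definition refl n (i : 'I_n.-1) : 'S_n := tperm (rlo i) (rhi i).

Definition plen n (w : 'S_n) : nat :=
  #|[set p : 'I_n * 'I_n | (p.1 < p.2)%N && (w p.2 < w p.1)%N]|.

(* [:: i1; ...; il] |-> r_{i1} o ... o r_{il}, composed as functions; recall
   that in MathComp (s * t) x = t (s x). *)
Definition word_perm n (s : seq 'I_n.-1) : 'S_n :=
  foldr (fun i w => (w * refl i)%g) 1%g s.

Definition reduced n (w : 'S_n) (s : seq 'I_n.-1) : bool :=
  (word_perm s == w) && (size s == plen w).

Lemma plen_refl n (w : 'S_n) (i : 'I_n.-1) :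
    ((w^-1)%g (rhi i) < (w^-1)%g (rlo i))%N ->
  plen w = (plen (w * refl i)%g).+1.
Proof.
set a := (w^-1)%g (rhi i); set b := (w^-1)%g (rlo i) => lt_ab.
have wa : w a = rhi i by rewrite permKV.
have wb : w b = rlo i by rewrite permKV.
rewrite /plen; set A := [set p | _]; set B := [set p | _].
have abB : (a, b) \notin B.
  rewrite inE /= !permM wa wb /refl tpermL tpermR /= lt_ab /=.
  by rewrite -leqNgt leqnSn.
suff -> : A = (a, b) |: B by rewrite cardsU1 abB.
apply/setP=> -[c d]; rewrite !inE /= !permM.
have [[-> ->]|ne_cd] := (c, d) =P (a, b).
  by rewrite wa wb lt_ab /= leqnn.
case: ltnP => //= lt_cd.
have ne : w c != w d.
  by apply/eqP=> /perm_inj cd; move: lt_cd; rewrite cd ltnn.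
rewrite /refl; case: tpermP => [wd|wd|/eqP d1 /eqP d2];
  case: tpermP => [wc|wc|/eqP c1 /eqP c2].
- by rewrite wc wd eqxx in ne.
- by case: ne_cd; congr pair; apply: (@perm_inj _ w); rewrite ?wa ?wb.
- by move: c1 c2; rewrite -!val_eqE wd /=; lia.
- have ca : c = b by apply: (@perm_inj _ w); rewrite wb.
  have da : d = a by apply: (@perm_inj _ w); rewrite wa.
  by move: lt_cd; rewrite ca da ltnNge (ltnW lt_ab).
- by rewrite wc wd eqxx in ne.
- by move: c1 c2; rewrite -!val_eqE wd /=; lia.
- by move: d1 d2; rewrite -!val_eqE wc /=; lia.
- by move: d1 d2; rewrite -!val_eqE wc /=; lia.
- by [].
Qed.

Lemma no_descent n (v : 'S_n) :
  (forall i : 'I_n.-1, v (rlo i) < v (rhi i))%N -> v = 1%g.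
Proof.
move=> inc; apply/permP=> x; rewrite perm1; apply/val_inj/eqP.
have step (m : nat) (lt1 : (m < n)%N) (lt2 : (m.+1 < n)%N) :
    (v (Ordinal lt1) < v (Ordinal lt2))%N.
  have lt_m : (m < n.-1)%N by lia.
  have := inc (Ordinal lt_m).
  have -> : rlo (Ordinal lt_m) = Ordinal lt1 by apply: val_inj.
  by have -> : rhi (Ordinal lt_m) = Ordinal lt2 by apply: val_inj.
rewrite eqn_leq; apply/andP; split; last first.
  case: x => m lt_m /=; elim: m lt_m => [//|m IHm] lt_m.
  by have := IHm (ltnW lt_m); have := step m (ltnW lt_m) lt_m; lia.
have up (d m : nat) (lt_m : (m < n)%N) :
    (n - m <= d -> v (Ordinal lt_m) <= m)%N.
  elim: d m lt_m => [|d IHd] m lt_m led; first by lia.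
  have [lt_m1|] := ltnP m.+1 n.
    have := IHd m.+1 lt_m1; have := step m lt_m lt_m1; lia.
  by have := ltn_ord (v (Ordinal lt_m)); lia.
by case: x => m lt_m; apply: (up (n - m)%N).
Qed.

Lemma ex_reduced n (w : 'S_n) : exists s, reduced w s.
Proof.
have [m] := ubnP (plen w); elim: m w => // m IHm w le_wm.
have [/existsP[i des]|] := boolP [exists i : 'I_n.-1,
    (w^-1)%g (rhi i) < (w^-1)%g (rlo i)]%N.
  have len := plen_refl des.
  have [|s /andP[/eqP sw /eqP ss]] := IHm (w * refl i)%g; first by lia.
  exists (i :: s); rewrite /reduced /= sw ss len eqxx andbT.
  by rewrite -mulgA /refl tperm2 mulg1.
rewrite negb_exists => /forallP nodes.
have /no_descent/(congr1 invg) : forall i : 'I_n.-1,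
    ((w^-1)%g (rlo i) < (w^-1)%g (rhi i))%N.
  move=> i; rewrite ltn_neqAle leqNgt nodes andbT.
  by rewrite val_eqE (inj_eq perm_inj) -val_eqE /=; lia.
rewrite invgK invg1 => ->; exists [::]; rewrite /reduced /= eqxx /=.
rewrite eq_sym cards_eq0; apply/eqP/setP=> -[c d]; rewrite !inE /= !perm1.
by lia.
Qed.

Definition reduced_word n (w : 'S_n) : seq 'I_n.-1 := xchoose (ex_reduced w).

(* The minimal length permutation w with l = w . w0.  As S_n is transitive on
   Gamma, the default value 1 is never returned when l lies in Gamma n k. *)
Definition wmin n k (l : Gamma n k) : 'S_n :=
  [arg min_(w < 1%g | actw w (w0 n k) == val l) plen w]%N.

(* Z[q][beta][X_0, ..., X_{n-1}], with X_i = e^{y_i}.  Inverting q, beta and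
   the X_i gives B, so both rings have the same field of fractions. *)
Definition Bpol (n : nat) := {mpoly {poly {poly int}}[n]}.

Definition FracB (n : nat) := {fraction (Bpol n)}.

Definition ofB n (p : Bpol n) : FracB n := tofrac p.

Definition ey n (i : 'I_n) : FracB n := ofB 'X_i.
Definition qq n : FracB n := ofB (('X%:P : {poly {poly int}})%:MP_[n]).
Definition bb n : FracB n := ofB (('X : {poly {poly int}})%:MP_[n]).
Definition QQ n : FracB n := qq n ^+ 2 + bb n - qq n ^+ 2 * bb n.

(* e^{y_i - y_j} *)
Definition eroot n (i j : 'I_n) : FracB n := ey i / ey j.

Lemma frac_numden (R : idomainType) (x : {fraction R}) :
  x = tofrac (\n_(repr x)) / tofrac (\d_(repr x)).
Proof.
have d0 : \d_(repr x) != 0 := denom_ratioP _.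
apply: (canRL (mulfK _)); first by rewrite tofrac_eq0.
move: (repr x) (reprK x) d0 => f <- f0.
rewrite !piE; apply/eqP; rewrite FracField.equivf_def /FracField.mulf.
by rewrite !numden_Ratio ?mulf_neq0 ?oner_neq0 // !mulr1 mulrC.
Qed.

(* The extension of an injective endomorphism of R to fractions. *)
Definition frac_map (R : idomainType) (f : R -> R) (x : {fraction R}) :
    {fraction R} :=
  tofrac (f (\n_(repr x))) / tofrac (f (\d_(repr x))).

Lemma frac_map_frac (R : idomainType) (f : {rmorphism R -> R}) (a b : R) :
    injective f -> b != 0 ->
  frac_map f (tofrac a / tofrac b) = tofrac (f a) / tofrac (f b).
Proof.
move=> f_inj b0; set x := tofrac a / tofrac b.
have f_neq0 (p : R) : p != 0 -> tofrac (f p) != 0.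
  rewrite tofrac_eq0; apply: contra => /eqP fp0.
  by apply/eqP/f_inj; rewrite fp0 rmorph0.
have tofrac_neq0 (p : R) : p != 0 -> tofrac p != 0 by rewrite tofrac_eq0.
have d0 : \d_(repr x) != 0 := denom_ratioP _.
have /eqP := frac_numden x.
rewrite {1}/x eqr_div ?tofrac_neq0 // -!tofracM tofrac_eq.
move=> /eqP/(congr1 f); rewrite !rmorphM => ad.
apply/eqP; rewrite /frac_map eq_sym eqr_div ?f_neq0 //; apply/eqP.
by rewrite -!tofracM ad.
Qed.

(* The action of W on Frac(B): e^{y_i} |-> e^{y_{w(i)}}, fixing q and beta. *)
Definition actF n (w : 'S_n) : FracB n -> FracB n :=
  frac_map (msym w : Bpol n -> Bpol n).

Lemma actF_frac n (w : 'S_n) (a b : Bpol n) :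
  b != 0 -> actF w (ofB a / ofB b) = ofB (msym w a) / ofB (msym w b).
Proof. exact: (@frac_map_frac _ (msym w) a b (@inj_msym _ _ w)). Qed.

(* The direct sum of the copies of Frac(B) indexed by Gamma. *)
Definition locclass n k := {ffun Gamma n k -> (FracB n)^o}.

Definition partial n k (i : 'I_n.-1) (f : locclass n k) : locclass n k :=
  let ea := eroot (rlo i) (rhi i) in
  [ffun m =>
     bb n * (1 - qq n ^+ 2) / (1 - ea^-1) * f m
     + (QQ n - qq n ^+ 2 * ea) / (1 - ea)
       * actF (refl i) (f (actG (refl i) m))].

(* The operators satisfy the braid relations, so that the composite does not
   depend on the reduced word. *)
Definition partial_perm n k (w : 'S_n) (f : locclass n k) : locclass n k :=
  foldr (fun i g => partial i g) f (reduced_word w).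

Definition Sw0 n k : locclass n k :=
  [ffun m => if val m == w0 n k then
     \prod_(p : 'I_n * 'I_n | (p.1 < k <= p.2)%N)
        ((1 - (eroot p.1 p.2)^-1) / (QQ n - qq n ^+ 2 * (eroot p.1 p.2)^-1))
   else 0].

Definition Segre n k (l : Gamma n k) : locclass n k :=
  partial_perm (wmin l) (Sw0 n k).

Inductive label := L0 | L1 | L10.

Definition label_code (x : label) : option bool :=
  match x with L0 => Some false | L1 => Some true | L10 => None end.
Definition label_decode (x : option bool) : label :=
  match x with Some false => L0 | Some true => L1 | None => L10 end.
Lemma label_codeK : cancel label_code label_decode. Proof. by case. Qed.

HB.instance Definition _ := Countable.copy label (can_type label_codeK).
HB.instance Definition _ : isFinite label := CanIsFinite label_codeK.

Definition letter (b : bool) : label := if b then L1 else L0.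

(* Pairs i <= j; with 1-based indices, (i, j) stands for both the edge
   g_{j,i-1} (strip j, just before it meets strip i) and the edge h_{i,j}. *)
Definition edge (n : nat) := {p : 'I_n * 'I_n | (p.1 <= p.2)%N}.

Definition rhombus (n : nat) := {p : 'I_n * 'I_n | (p.1 < p.2)%N}.

Section Geometry.
Variables (n : nat) (r : rhombus n).

Lemma inner_subproof : ((val r).1.+1 < n)%N.
Proof. exact: leq_ltn_trans (valP r) (ltn_ord _). Qed.

Lemma outer_subproof : ((val r).2.-1 < n)%N.
Proof. exact: leq_ltn_trans (leq_pred _) (ltn_ord _). Qed.

Lemma sw_subproof : ((val r).1 <= Ordinal outer_subproof)%N.
Proof. by have := valP r; rewrite /=; lia. Qed.

(* The index of the NW edge (among the g) and of the NE edge (among the h). *)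
Definition top_edge : edge n :=
  exist _ (val r) (ltnW (valP r)).

(* The SW edge h_{i,j-1}. *)
Definition sw_edge : edge n :=
  exist (fun p : 'I_n * 'I_n => (p.1 <= p.2)%N)
        ((val r).1, Ordinal outer_subproof) sw_subproof.

(* The SE edge g_{j,i}. *)
Definition se_edge : edge n :=
  exist (fun p : 'I_n * 'I_n => (p.1 <= p.2)%N)
        (Ordinal inner_subproof, (val r).2) (valP r).

End Geometry.

Definition diag_edge n (i : 'I_n) : edge n :=
  exist (fun p : 'I_n * 'I_n => (p.1 <= p.2)%N) (i, i) (leqnn i).

(* The labels g, h and those of the bottom edges. *)
Definition labelling (n : nat) :=
  ({ffun edge n -> label} * {ffun edge n -> label} * {ffun 'I_n -> label})%type.

Definition glab n (P : labelling n) (e : edge n) : label := P.1.1 e.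
Definition hlab n (P : labelling n) (e : edge n) : label := P.1.2 e.
Definition blab n (P : labelling n) (i : 'I_n) : label := P.2 i.

(* In the two fugacity functions, None means that the tile is not allowed. *)
Definition triangle_fug n (nw b ne : label) : option (FracB n) :=
  match nw, b, ne with
  | L0, L0, L0 | L1, L1, L1 | L0, L1, L10 | L10, L0, L1 => Some 1
  | _, _, _ => None
  end.

Definition rhombus_fug n (z : FracB n) (nw ne sw se : label) :
    option (FracB n) :=
  let q := qq n in let Q := QQ n in
  let a := bb n * (1 - q ^+ 2) in
  let E := Q - q ^+ 2 * z in
  match nw, ne, sw, se with
  | L0, L0, L0, L0 | L1, L1, L1, L1 | L1, L0, L0, L1
  | L10, L1, L1, L10 | L0, L10, L10, L0 => Some 1
  | L10, L10, L10, L10 => Some Q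
  | L0, L0, L1, L10 | L1, L1, L10, L0 => Some (a / E)
  | L0, L10, L1, L1 | L10, L1, L0, L0 => Some (a * z / E)
  | L0, L1, L1, L0 => Some (q * (1 - z) / E)
  | L10, L0, L0, L10 | L1, L10, L10, L1 => Some (q * Q * (1 - z) / E)
  | L1, L0, L10, L10 => Some (- (q * a / E))
  | L10, L10, L0, L1 => Some (- (a * Q * z / (q * E)))
  | _, _, _, _ => None
  end.

Definition triangle_at n (P : labelling n) (i : 'I_n) : option (FracB n) :=
  triangle_fug n (glab P (diag_edge i)) (blab P i) (hlab P (diag_edge i)).

Definition rhombus_at n (P : labelling n) (r : rhombus n) : option (FracB n) :=
  rhombus_fug (eroot (val r).2 (val r).1)
    (glab P (top_edge r)) (hlab P (top_edge r))
    (hlab P (sw_edge r)) (glab P (se_edge r)).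

Definition is_puzzle n (l m u : word n) (P : labelling n) : bool :=
  [&& [forall e : edge n,
         ((val e).1 == 0%N :> nat) ==> (glab P e == letter (l (val e).2))],
      [forall e : edge n,
         ((val e).2 == n.-1 :> nat) ==> (hlab P e == letter (m (val e).1))],
      [forall i, blab P i == letter (u i)],
      [forall r, rhombus_at P r : bool]
    & [forall i, triangle_at P i : bool]].

Definition fug n (P : labelling n) : FracB n :=
  (\prod_(r : rhombus n) odflt 0 (rhombus_at P r))
  * (\prod_(i < n) odflt 0 (triangle_at P i)).

(* Main.v *)
Require Import Defs.
From mathcomp Require Import all_boot all_order all_algebra all_fingroup.
From mathcomp Require Import fraction mpoly.
From HB Require Import structures.
From mathcomp Require Import ring zify.
Set Implicit Arguments.
Unset Strict Implicit.
Unset Printing Implicit Defensive.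
Import GRing.Theory.
Local Open Scope ring_scope.

(** A puzzle is a lattice model.  The strip above the j-th bottom edge that
    starts at the north-west side is a line g_j, which enters with the label
    lambda_j; the one that starts at the north-east side is a line h_i, which
    enters with the label mu_i; the rhombus (i, j) is the crossing of h_i and
    g_j, with spectral parameter e^{y_j - y_i}.  The fugacities of the rhombi
    form an R-matrix on the three labels 0, 1, 10.  There are companion
    R-matrices Rg and Rh that exchange two neighbouring g lines and two
    neighbouring h lines, and they satisfy the Yang-Baxter equations [ybe_g]
    and [ybe_h].  Where the lines g_i, g_{i+1}, h_i, h_{i+1} end in the bottom
    triangles, both exchanges turn into one exchange of the bottom labels
    ([fusion]).  Sliding exchanges through the whole puzzle shows that the
    puzzle sums intertwine the action of the R-matrix on lambda and mu with
    its action on nu, while y_i and y_{i+1} are interchanged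
    ([puzzle_sum_intertwine]).

    The classes q^{ell(lambda)} S_lambda obey the same R-matrix: their
    restrictions to the fixed point r_i sigma are obtained from those to sigma
    by applying r_i to the values and the R-matrix to the index lambda
    ([qS_wrefl]).  Hence the product rule at sigma implies the product rule at
    r_i sigma, and it is enough to check it at the single point
    sigma = 0^{n-k} 1^k.  There all S_lambda vanish except S_sigma, whose value
    is 1 ([segre_support], [segre_diag]), and a puzzle whose bottom side is
    sorted is unique and has fugacity 1 ([puzzle_sum_top]).

    To compare neighbouring fixed points one needs the operators d_i on the
    span of the classes.  If lambda reads 01 at i, i+1 then
    S_lambda = d_i S_{r_i lambda}, whichever reduced word defines the classes:
    two positions where a word reads 01 are never adjacent, so two ways of
    reaching lambda differ by commutations only ([climb_uniq]).  If the two
    letters are equal then d_i S_lambda = Q S_lambda, by the braid relation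
    ([DL_same]).  The case 10 follows from the quadratic relation
    ([DL_quad]).

    All of this takes place over an arbitrary field with parameters q, Q and y
    on which the simple reflections act; the fraction field of B enters only at
    the end. *)

(** * Rhombi, triangles and the exchange of two lines *)
Section Weights.
Variables (K : fieldType) (q Q : K).

Definition den z := Q - q ^+ 2 * z.

(** The rhombus with SW edge d and NW edge g as a functional: the sum over its
    NE and SE edges d', g' of its fugacity times F d' g'.  With this encoding a
    strip of rhombi is a composite, and the Yang-Baxter equation has no sums
    over labels. *)
Definition cross z (d g : label) (F : label -> label -> K) : K :=
  let a := Q - q ^+ 2 in let E := den z in
  match d, g with
  | L0, L0 => F L0 L0
  | L0, L1 => F L0 L1
  | L0, L10 => a * z / E * F L1 L0 + q * Q * (1 - z) / E * F L0 L10
               + - (a * Q * z / (q * E)) * F L10 L1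
  | L1, L0 => a / E * F L0 L10 + a * z / E * F L10 L1 + q * (1 - z) / E * F L1 L0
  | L1, L1 => F L1 L1
  | L1, L10 => F L1 L10
  | L10, L0 => F L10 L0
  | L10, L1 => a / E * F L1 L0 + q * Q * (1 - z) / E * F L10 L1
               + - (q * a / E) * F L0 L10
  | L10, L10 => Q * F L10 L10
  end.

(** F receives the NE label of the triangle with NW edge g and bottom edge v. *)
Definition triangle_op (g : label) (v : bool) (F : label -> K) : K :=
  match g, v with
  | L0, false => F L0
  | L1, true => F L1
  | L0, true => F L10
  | L10, false => F L1
  | _, _ => 0
  end.

(** An R-matrix preserves an ordered pair of distinct labels with a weight that
    depends on which of the two is smaller.  The order differs for g lines and
    h lines, but both orders put 0 before 1, so that the two R-matrices agree
    on words. *)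
Definition rank_g (x : label) : nat :=
  match x with L10 => 0%N | L0 => 1%N | L1 => 2%N end.
Definition rank_h (x : label) : nat :=
  match x with L0 => 0%N | L1 => 1%N | L10 => 2%N end.

(** In stay and swap, w is the ratio of the parameters e^y of the second and the
    first line. *)
Definition stay (rank : label -> nat) w (x y : label) : K :=
  (Q - q ^+ 2) * (if (rank x < rank y)%N then 1 else w) / den w.

Definition swap w (x y : label) : K :=
  q * (match x, y with L0, L1 | L0, L10 | L10, L1 => Q | _, _ => 1 end)
  * (1 - w) / den w.

Definition Rop (T : eqType) (st sw : T -> T -> K) (F : T -> T -> K) x y : K :=
  if x == y then F x y else st x y * F x y + sw x y * F y x.

Definition Rg w := Rop (stay rank_g w) (swap w).
(** RhT is the transpose of Rh: it acts on the labels with which the lines enter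
    a puzzle rather than on the sides prescribed for them. *)
Definition Rh w := Rop (stay rank_h w) (swap w).
Definition RhT w := Rop (stay rank_h w) (fun x y => swap w y x).
Definition Rb w := Rop (fun x y => stay rank_h w (letter x) (letter y))
  (fun x y => swap w (letter x) (letter y)).
Definition RbT w := Rop (fun x y => stay rank_h w (letter x) (letter y))
  (fun x y => swap w (letter y) (letter x)).

(** Two g lines may be exchanged before or after they cross an h line. *)
Lemma ybe_g z w d x y F : q != 0 ->
  den z != 0 -> den w != 0 -> den (w * z) != 0 ->
  Rg w (fun x y => cross (w * z) d x (fun d1 x' =>
    cross z d1 y (fun d2 y' => F d2 x' y'))) x y
  = cross z d x (fun d1 x' => cross (w * z) d1 y (fun d2 y' =>
    Rg w (F d2) x' y')).
Proof.
rewrite /den => q0 h1 h2 h3.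
by case: d; case: x; case: y; rewrite /Rg /Rop /stay /swap /cross /= /den;
  field; rewrite ?q0 ?h1 ?h2 ?h3.
Qed.

(** The same for two h lines that cross a g line.  Labels travel along h lines
    against the direction of the functional, hence the transpose. *)
Lemma ybe_h z w d e g F : q != 0 ->
  den z != 0 -> den w != 0 -> den (w * z) != 0 ->
  cross z d g (fun d' g1 => cross (w * z) e g1 (fun e' g2 =>
    RhT w (fun d' e' => F d' e' g2) d' e'))
  = RhT w (fun d e => cross (w * z) d g (fun d' g1 =>
    cross z e g1 (fun e' g2 => F d' e' g2))) d e.
Proof.
rewrite /den => q0 h1 h2 h3.
by case: d; case: e; case: g; rewrite /RhT /Rop /stay /swap /cross /= /den;
  field; rewrite ?q0 ?h1 ?h2 ?h3.
Qed.

(** The corner made of two neighbouring triangles and the rhombus on top of them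
    turns an exchange of both pairs of lines into an exchange of the bottom
    labels.  Since the lines are interchanged, the rhombus has parameter w^-1
    on one side and w on the other. *)
Lemma fusion w x y u v F : q != 0 -> w != 0 -> den w != 0 -> den w^-1 != 0 ->
  Rg w (fun x y => triangle_op x u (fun d => cross w^-1 d y (fun d' y' =>
     triangle_op y' v (fun e => RhT w F d' e)))) x y
  = RbT w (fun u v => triangle_op x u (fun d => cross w d y (fun d' y' =>
     triangle_op y' v (fun e => F d' e)))) u v.
Proof.
rewrite /den => q0 w0 h1 h2.
have h3 : Q * w - q ^+ 2 != 0.
  have -> : Q * w - q ^+ 2 = w * (Q - q ^+ 2 * w^-1) by field.
  by rewrite mulf_neq0.
case: x; case: y; case: u; case: v;
  rewrite /Rg /RbT /RhT /Rop /stay /swap /triangle_op /cross /= /den;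
  try ring.
all: by field; rewrite ?q0 ?w0 ?h1 ?h3.
Qed.

End Weights.

(** * Functionals that are finite sums of evaluations *)
Section FormalSums.
Variable K : fieldType.

(** Every operator of the lattice model is of this form.  Two such functionals
    in independent variables commute, which replaces all interchanges of sums
    over labels, even where the variables are lists. *)
Definition finitary T (Phi : (T -> K) -> K) : Prop :=
  exists r : seq (K * T), forall F, Phi F = \sum_(t <- r) t.1 * F t.2.

Lemma finitary_swap S T (Phi : (S -> K) -> K) (Psi : (T -> K) -> K) F :
  finitary Phi -> finitary Psi ->
  Phi (fun x => Psi (F x)) = Psi (fun y => Phi (fun x => F x y)).
Proof.
move=> [r Phir] [s Psis]; rewrite Phir Psis.
under eq_bigr => t _ do rewrite Psis mulr_sumr.
rewrite exchange_big /=; apply: eq_bigr => t _; rewrite Phir mulr_sumr.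
by apply: eq_bigr => u _; rewrite mulrCA.
Qed.

Lemma finitary_bind S T (Phi : (S -> K) -> K) (Psi : S -> (T -> K) -> K) :
  finitary Phi -> (forall x, finitary (Psi x)) ->
  finitary (fun F => Phi (fun x => Psi x F)).
Proof.
move=> [r Phir] Psis.
suff [s sE] : exists s : seq (K * T), forall F,
    \sum_(t <- r) t.1 * Psi t.2 F = \sum_(u <- s) u.1 * F u.2.
  by exists s => F; rewrite Phir.
elim: r {Phir} => [|[c x] r [t tE]]; first by exists [::] => F; rewrite !big_nil.
have [s sE] := Psis x; exists ([seq (c * u.1, u.2) | u <- s] ++ t) => F.
rewrite big_cons big_cat /= -tE sE mulr_sumr big_map; congr (_ + _).
by apply: eq_bigr => u _; rewrite mulrA.
Qed.

Lemma finitary_ext T (Phi : (T -> K) -> K) F G : finitary Phi -> F =1 G -> Phi F = Phi G.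
Proof. by move=> [r rE] e; rewrite !rE; apply: eq_bigr => t _; rewrite e. Qed.

Lemma finitary0 T (Phi : (T -> K) -> K) : finitary Phi -> Phi (fun _ => 0) = 0.
Proof. by move=> [r ->]; rewrite big1 // => t _; rewrite mulr0. Qed.

Lemma finitary_if T (Phi : (T -> K) -> K) (b : bool) F :
  finitary Phi -> Phi (fun x => if b then F x else 0) = if b then Phi F else 0.
Proof. by case: b => // /finitary0. Qed.

Lemma finitary_map S T (f : S -> T) (Phi : (S -> K) -> K) :
  finitary Phi -> finitary (fun F => Phi (fun x => F (f x))).
Proof.
case=> r rE; exists [seq (t.1, f t.2) | t <- r] => F.
by rewrite rE big_map.
Qed.

Definition finitary2 S T (Phi : (S -> T -> K) -> K) : Prop :=
  finitary (fun F : S * T -> K => Phi (fun x y => F (x, y))).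

End FormalSums.

(** * The exchange relation for puzzles *)
Section Exchange.
Variables (K : fieldType) (q Q : K).
Local Notation den := (den q Q).
Local Notation cross := (cross q Q).
Local Notation Rg := (Rg q Q).
Local Notation RhT := (RhT q Q).
Local Notation Rh := (Rh q Q).
Local Notation Rb := (Rb q Q).
Local Notation RbT := (RbT q Q).
Local Notation triangle_op := (@triangle_op K).

Lemma finitary2_cross z d g : finitary2 (cross z d g).
Proof.
rewrite /finitary2 /cross; case: d; case: g;
  first [ eexists [:: (1, (_, _))] => F; by rewrite big_seq1 mul1r
        | eexists [:: (_, (_, _))] => F; by rewrite big_seq1
        | eexists [:: (_, (_, _)); (_, (_, _)); (_, (_, _))] => F;
          by rewrite !big_cons big_nil addr0 addrA ].
Qed.

Lemma finitary_triangle g v : finitary (triangle_op g v).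
Proof.
by case: g; case: v; first [ by exists [::] => F; rewrite big_nil
   | by eexists [:: (1, _)] => F; rewrite big_seq1 mul1r ].
Qed.

Lemma finitary2_Rop (T : eqType) (st sw : T -> T -> K) x y :
  finitary2 (fun F => Rop st sw F x y).
Proof.
rewrite /finitary2 /Rop; case: eqP => _.
  by eexists [:: (1, (_, _))] => F; rewrite big_seq1 mul1r.
by eexists [:: (_, (_, _)); (_, (_, _))] => F; rewrite !big_cons big_nil addr0.
Qed.

Lemma finitary2_Rg w x y : finitary2 (fun F => Rg w F x y).
Proof. exact: finitary2_Rop. Qed.

Lemma finitary2_Rh w x y : finitary2 (fun F => Rh w F x y).
Proof. exact: finitary2_Rop. Qed.

Lemma finitary2_RbT w x y : finitary2 (fun F => RbT w F x y).
Proof. exact: finitary2_Rop. Qed.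

(** The strip of the h line with parameter y1, which leaves with the label d
    after crossing the lines gs with parameters ys.  F receives the label with
    which the h line enters and the labels of the g lines below the strip. *)
Fixpoint strip y1 (ys : seq K) (gs : seq label) (d : label)
    (F : label -> seq label -> K) : K :=
  match ys, gs with
  | y :: ys', g :: gs' =>
      cross (y / y1) d g (fun d' g' =>
        strip y1 ys' gs' d' (fun d0 s => F d0 (g' :: s)))
  | _, _ => F d [::]
  end.

(** The sum over puzzles, computed by removing the strip of the first h line:
    what remains is a puzzle with one line fewer, whose north-west side consists
    of the labels below that strip. *)
Fixpoint puzzle_sum (ys : seq K) (gs hs : seq label) (vs : seq bool) : K :=
  match ys, gs, hs, vs with
  | y :: ys', g :: gs', h :: hs', v :: vs' =>
      triangle_op g v (fun d => strip y ys' gs' d (fun d0 s =>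
        if d0 == h then puzzle_sum ys' s hs' vs' else 0))
  | _, _, _, _ => 1
  end.

Fixpoint at_pos T (op : (T -> T -> K) -> T -> T -> K) i (F : seq T -> K) s : K :=
  match i, s with
  | 0%N, x :: y :: s' => op (fun a b => F [:: a, b & s']) x y
  | j.+1, x :: s' => at_pos op j (fun t => F (x :: t)) s'
  | _, _ => F s
  end.

Fixpoint swap_at T i (s : seq T) : seq T :=
  match i, s with
  | 0%N, x :: y :: s' => [:: y, x & s']
  | j.+1, x :: s' => x :: swap_at j s'
  | _, _ => s
  end.

Lemma size_swap_at T i (s : seq T) : size (swap_at i s) = size s.
Proof. by elim: i s => [|i IHi] [|x [|y s]] //=; rewrite IHi. Qed.

Lemma finitary2_strip y1 ys gs d : finitary2 (strip y1 ys gs d).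
Proof.
elim: ys gs d => [|y ys IHy] [|g gs] d /=;
  try by eexists [:: (1, (_, _))] => F; rewrite big_seq1 mul1r.
apply: (@finitary_bind _ _ _ _ (fun p F => strip y1 ys gs p.1
  (fun d0 s => F (d0, p.2 :: s))) (finitary2_cross (y / y1) d g)) => -[d' g'] /=.
exact: (finitary_map (fun p => (p.1, g' :: p.2)) (IHy gs d')).
Qed.

Lemma finitary_at T op i (s : seq T) :
  (forall x y, finitary2 (fun F => op F x y)) -> finitary (fun F => at_pos op i F s).
Proof.
move=> ops; elim: i s => [|i IHi] [|x [|y s]] /=;
  try by eexists [:: (1, _)] => F; rewrite big_seq1 mul1r.
- exact: (finitary_map (fun p => [:: p.1, p.2 & s]) (ops x y)).
- exact: (finitary_map (cons x) (IHi [::])).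
- exact: (finitary_map (cons x) (IHi (y :: s))).
Qed.

Lemma finitary2_ext S T (Phi : (S -> T -> K) -> K) F G :
  finitary2 Phi -> F =2 G -> Phi F = Phi G.
Proof.
move=> Phis e.
by apply: (finitary_ext (F := fun p => F p.1 p.2) (G := fun p => G p.1 p.2) Phis) => -[].
Qed.

Lemma finitary2_swap R S T (Phi : (R -> S -> K) -> K) (Psi : (T -> K) -> K) F :
  finitary2 Phi -> finitary Psi ->
  Phi (fun x x' => Psi (F x x')) = Psi (fun y => Phi (fun x x' => F x x' y)).
Proof.
move=> Phis Psis.
exact: (finitary_swap (fun p => F p.1 p.2) Phis Psis).
Qed.

Lemma finitary22_swap R S T U (Phi : (R -> S -> K) -> K) (Psi : (T -> U -> K) -> K) F :
  finitary2 Phi -> finitary2 Psi ->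
  Phi (fun x x' => Psi (F x x')) = Psi (fun y y' => Phi (fun x x' => F x x' y y')).
Proof.
move=> Phis Psis.
exact: (finitary_swap (fun p r => F p.1 p.2 r.1 r.2) Phis Psis).
Qed.

Lemma strip_ext y1 ys gs d F G : size ys = size gs ->
  (forall d0 s, size s = size gs -> F d0 s = G d0 s) ->
  strip y1 ys gs d F = strip y1 ys gs d G.
Proof.
elim: ys gs d F G => [|y ys IHy] [|g gs] d F G //=; first by move=> _; exact.
move=> [sz] e; apply: finitary2_ext (finitary2_cross _ _ _) _ => d' g'.
by apply: IHy => // d0 s ss; apply: e; rewrite /= ss.
Qed.

(** No denominator vanishes, whichever two lines meet and in either order. *)
Definition generic (ys : seq K) :=
  all (fun y => y != 0) ys
  && pairwise (fun y z => (den (y / z) != 0) && (den (z / y) != 0)) ys.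

(** An exchange of two g lines slides through the strip: rhombi before and after
    the two lines commute with it, the two rhombi on them are [ybe_g]. *)
Lemma strip_Rg y1 ys gs d i F : q != 0 -> size ys = size gs -> (i.+1 < size ys)%N ->
  generic (y1 :: ys) ->
  let w := nth 0 ys i.+1 / nth 0 ys i in
  at_pos (Rg w) i (fun s => strip y1 (swap_at i ys) s d F) gs
  = strip y1 ys gs d (fun d0 => at_pos (Rg w) i (F d0)).
Proof.
move=> q0; elim: i ys gs d F => [|i IHi] [|y ys] [|g gs] d F //= [].
  case: ys gs => [|z ys] [|h gs] //= _ _.
  rewrite /generic /= => /andP[/and4P[y10 y0 z0 _] /andP[]].
  case/and3P=> /andP[_ e1] /andP[_ e2] _ /andP[/andP[/andP[_ e3] _] _].
  have -> : z / y1 = (z / y) * (y / y1) by field; rewrite y0 y10.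
  rewrite ybe_g //; last first.
    by have <- : z / y1 = (z / y) * (y / y1) by field; rewrite y0 y10.
  apply: finitary2_ext (finitary2_cross _ _ _) _ => d1 g1.
  apply: finitary2_ext (finitary2_cross _ _ _) _ => d2 g2.
  have := finitary22_swap (fun a b d0 s => F d0 [:: a, b & s])
    (finitary2_Rg (z / y) g1 g2) (finitary2_strip y1 ys gs d2).
  exact.
move=> sz lt_i gen.
transitivity (cross (y / y1) d g (fun d' g' =>
    at_pos (Rg (nth 0 ys i.+1 / nth 0 ys i)) i (fun s =>
      strip y1 (swap_at i ys) s d' (fun d0 s => F d0 (g' :: s))) gs)).
  have Rg_gs := finitary_at i gs (finitary2_Rg (nth 0 ys i.+1 / nth 0 ys i)).
  exact/esym/(finitary2_swap (fun d' g' s =>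
      strip y1 (swap_at i ys) s d' (fun d0 s => F d0 (g' :: s)))
    (finitary2_cross _ _ _) Rg_gs).
apply: finitary2_ext (finitary2_cross _ _ _) _ => d1 g1.
rewrite -[RHS]IHi //.
by move: gen; rewrite /generic /= => /andP[/and3P[-> _ ->] /and3P[/andP[_ ->] _ ->]].
Qed.

(** An exchange of two h lines slides through their common strip, one g line at
    a time by [ybe_h]. *)
Lemma strip_Rh y1 y2 ys gs d e F : q != 0 ->
  generic [:: y1, y2 & ys] -> size ys = size gs ->
  let w := y2 / y1 in
  strip y2 ys gs d (fun d0 s => strip y1 ys s e (fun e0 t =>
    RhT w (fun d0 e0 => F d0 e0 t) d0 e0))
  = RhT w (fun d e => strip y1 ys gs d (fun d0 s => strip y2 ys s e (fun e0 t =>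
      F d0 e0 t))) d e.
Proof.
move=> q0 + + w; elim: ys gs d e F => [|y ys IHy] [|g gs] d e F //= gen [sz].
have gen' : generic [:: y1, y2 & ys].
  move: gen; rewrite /generic /= => /andP[/and4P[-> -> _ ->]] /=.
  by case/and3P=> /and3P[-> _ ->] /andP[_ ->] /andP[_ ->].
have [y20 [zw e1 e2 e3]] : y2 != 0 /\
  [/\ y / y1 = w * (y / y2), den (y / y2) != 0, den w != 0 & den (y / y1) != 0].
  move: gen; rewrite /generic /= => /andP[/and4P[y10 y20 _ _]] /=.
  case/and3P=> /and3P[/andP[_ ->] /andP[_ ->] _] /andP[/andP[_ ->] _] _.
  by do !split=> //; rewrite /w; field; rewrite y20 y10.
under (finitary2_ext (finitary2_cross _ _ _)) => d' g'.
  rewrite (@finitary22_swap _ _ _ _ (strip y2 ys gs d') (cross (y / y1) e g')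
   (fun d0 s e' g'' => strip y1 ys s e' (fun e0 t =>
      RhT w (fun d0 e0 => F d0 e0 (g'' :: t)) d0 e0)));
    [|exact: finitary2_strip|exact: finitary2_cross].
  over.
under (finitary2_ext (finitary2_cross _ _ _)) => d' g'.
  under (finitary2_ext (finitary2_cross _ _ _)) => e' g''.
    rewrite (IHy gs d' e' (fun d0 e0 t => F d0 e0 (g'' :: t))) //.
  over.
over.
rewrite zw ybe_h -?zw //.
have RhT_ext : forall H H' : label -> label -> K, H =2 H' -> RhT w H d e = RhT w H' d e.
  by move=> H H' HH; rewrite /RhT /Rop !HH.
apply: RhT_ext => d1 e1'; apply: finitary2_ext (finitary2_cross _ _ _) _ => d' g'.
symmetry.
apply: (@finitary22_swap _ _ _ _ (strip y1 ys gs d') (cross (y / y2) e1' g')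
   (fun d0 s e' g'' => strip y2 ys s e' (fun e0 t => F d0 e0 (g'' :: t))));
  [exact: finitary2_strip|exact: finitary2_cross].
Qed.

Lemma Rg_letter w F (x y : bool) :
  Rg w F (letter x) (letter y) = Rb w (fun a b => F (letter a) (letter b)) x y.
Proof. by case: x; case: y. Qed.

Lemma Rh_letter w F (x y : bool) :
  Rh w F (letter x) (letter y) = Rb w (fun a b => F (letter a) (letter b)) x y.
Proof. by case: x; case: y. Qed.

(** Exchanging the prescribed labels c, d is the same as exchanging the labels
    c', d' with which the lines enter. *)
Lemma Rh_match w (c d c' d' : label) X :
  Rh w (fun c d => if c' == c then if d' == d then X else 0 else 0) c d
  = RhT w (fun c' d' => if c' == c then if d' == d then X else 0 else 0) c' d'.
Proof.
by case: c; case: d; case: c'; case: d';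
  rewrite /Rh /RhT /Rop /= ?mulr0 ?addr0 ?add0r.
Qed.

Lemma generic_behead y ys : generic (y :: ys) -> generic ys.
Proof. by rewrite /generic /= => /andP[/andP[_ ->] /andP[_ ->]]. Qed.

(** Strips of the h lines before position i are passed with [strip_Rg], and
    induction applies to the puzzle below.  At position i the exchange of the h
    lines passes the g lines beyond them by [strip_Rh] and meets the exchange of
    the g lines at the bottom, where [fusion] applies. *)
Theorem puzzle_sum_intertwine i ys gs hs vs : q != 0 -> generic ys ->
  size gs = size ys -> size hs = size ys -> size vs = size ys ->
  (i.+1 < size ys)%N ->
  let w := nth 0 ys i.+1 / nth 0 ys i in
  at_pos (Rg w) i (fun gs => at_pos (Rh w) i (fun hs =>
    puzzle_sum (swap_at i ys) gs hs vs) hs) gs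
  = at_pos (RbT w) i (fun vs => puzzle_sum ys gs hs vs) vs.
Proof.
move=> q0; elim: i ys gs hs vs => [|i IHi] [|y1 ys] [|a gs] [|c hs] [|u vs] //=.
  case: ys gs hs vs => [|y2 ys] [|b gs] [|d hs] [|v vs] //= gen [sg] [sh] [sv] _.
  set w := y2 / y1.
  have [y20 y10] : y2 != 0 /\ y1 != 0.
    by move: gen; rewrite /generic /= => /andP[/and3P[-> ->]].
  have [e1 e2] : den w != 0 /\ den w^-1 != 0.
    move: gen; rewrite /generic /w invf_div /= => /andP[_ /andP[/andP[/andP[-> ->] _] _]] //.
  have w0 : w != 0 by rewrite mulf_neq0 ?invr_eq0.
  (* The second triangle is moved in front of both long strips. *)
  have puzzleE c' d' u' v' y y' a' b' :
    puzzle_sum [:: y, y' & ys] [:: a', b' & gs] [:: c', d' & hs] [:: u', v' & vs]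
    = triangle_op a' u' (fun x => cross (y' / y) x b' (fun x' g' =>
        triangle_op g' v' (fun e =>
        strip y ys gs x' (fun d0 s => strip y' ys s e (fun e0 t =>
          if d0 == c' then if e0 == d' then puzzle_sum ys t hs vs else 0 else 0))))).
    rewrite /=; apply: finitary_ext (finitary_triangle _ _) _ => x.
    apply: finitary2_ext (finitary2_cross _ _ _) _ => x' g'.
    rewrite -(finitary2_swap (fun d0 s e => strip y' ys s e (fun e0 t =>
      if d0 == c' then if e0 == d' then puzzle_sum ys t hs vs else 0 else 0))
      (finitary2_strip y ys gs x') (finitary_triangle g' v')).
    apply: finitary2_ext (finitary2_strip _ _ _ _) _ => d0 s.
    case: (d0 == c') => //; rewrite -[LHS](finitary0 (finitary_triangle g' v')).
    apply: finitary_ext (finitary_triangle _ _) _ => e; apply/esym.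
    exact: (finitary0 (finitary2_strip y' ys s e)).
  have sw : y1 / y2 = w^-1 by rewrite invf_div.
  pose G x e := strip y1 ys gs x (fun d0 s => strip y2 ys s e (fun e0 t =>
          if d0 == c then if e0 == d then puzzle_sum ys t hs vs else 0 else 0)).
  transitivity (Rg w (fun a b => Rh w (fun c d =>
      puzzle_sum [:: y2, y1 & ys] [:: a, b & gs] [:: c, d & hs] [:: u, v & vs]) c d) a b).
    by [].
  (* The exchange of the h lines is carried down to the two triangles. *)
  transitivity (Rg w (fun a b => triangle_op a u (fun x => cross w^-1 x b (fun x' g' =>
     triangle_op g' v (fun e => RhT w G x' e)))) a b).
    apply: (finitary2_ext (finitary2_Rg _ _ _)) => {}a {}b.
    under (finitary2_ext (finitary2_Rh _ _ _)) => c' d' do rewrite puzzleE sw.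
    rewrite (finitary2_swap (fun c' d' x => cross w^-1 x b (fun x' g' => triangle_op g' v (fun e =>
        strip y2 ys gs x' (fun d0 s => strip y1 ys s e (fun e0 t =>
          if d0 == c' then if e0 == d' then puzzle_sum ys t hs vs else 0 else 0)))))
      (finitary2_Rh w c d) (finitary_triangle a u)).
    apply: finitary_ext (finitary_triangle _ _) _ => x.
    rewrite (finitary22_swap (fun c' d' x' g' => triangle_op g' v (fun e =>
        strip y2 ys gs x' (fun d0 s => strip y1 ys s e (fun e0 t =>
          if d0 == c' then if e0 == d' then puzzle_sum ys t hs vs else 0 else 0))))
      (finitary2_Rh w c d) (finitary2_cross _ _ _)).
    apply: finitary2_ext (finitary2_cross _ _ _) _ => x' g'.
    rewrite (finitary2_swap (fun c' d' e =>
        strip y2 ys gs x' (fun d0 s => strip y1 ys s e (fun e0 t =>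
          if d0 == c' then if e0 == d' then puzzle_sum ys t hs vs else 0 else 0)))
      (finitary2_Rh w c d) (finitary_triangle _ _)).
    apply: finitary_ext (finitary_triangle _ _) _ => e.
    rewrite (finitary22_swap (fun c' d' d0 s => strip y1 ys s e (fun e0 t =>
          if d0 == c' then if e0 == d' then puzzle_sum ys t hs vs else 0 else 0))
      (finitary2_Rh w c d) (finitary2_strip _ _ _ _)).
    rewrite /G -strip_Rh //.
    apply: finitary2_ext (finitary2_strip _ _ _ _) _ => d0 s.
    rewrite (finitary22_swap (fun c' d' e0 t =>
          if d0 == c' then if e0 == d' then puzzle_sum ys t hs vs else 0 else 0)
      (finitary2_Rh w c d) (finitary2_strip _ _ _ _)).
    apply: finitary2_ext (finitary2_strip _ _ _ _) _ => e0 t.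
    exact: Rh_match.
  rewrite (fusion a b u v G q0 w0 e1 e2).
  apply: finitary2_ext (finitary2_RbT _ _ _) _ => u' v'.
  exact/esym/puzzleE.
move=> gen [sg] [sh] [sv] lt_i; set w := _ / _.
have Rh_s := finitary_at i hs (finitary2_Rh w).
have Rg_s := finitary_at i gs (finitary2_Rg w).
transitivity (triangle_op a u (fun d => at_pos (Rg w) i (fun gs =>
  strip y1 (swap_at i ys) gs d (fun d0 s => if d0 == c
    then at_pos (Rh w) i (fun hs => puzzle_sum (swap_at i ys) s hs vs) hs
    else 0)) gs)).
  rewrite (finitary_swap (fun d gs => strip y1 (swap_at i ys) gs d (fun d0 s =>
    if d0 == c
    then at_pos (Rh w) i (fun hs => puzzle_sum (swap_at i ys) s hs vs) hs
    else 0)) (finitary_triangle a u) Rg_s).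
  apply: finitary_ext Rg_s _ => s.
  rewrite -(finitary_swap (fun d hs => strip y1 (swap_at i ys) s d (fun d0 s =>
   if d0 == c then puzzle_sum (swap_at i ys) s hs vs else 0)) (finitary_triangle a u) Rh_s).
  apply: finitary_ext (finitary_triangle _ _) _ => d.
  rewrite -(finitary2_swap (fun d0 s hs =>
    if d0 == c then puzzle_sum (swap_at i ys) s hs vs else 0)
    (finitary2_strip _ _ _ _) Rh_s).
  apply: finitary2_ext (finitary2_strip _ _ _ _) _ => d0 t.
  exact: (finitary_if (d0 == c) (fun hs => puzzle_sum (swap_at i ys) t hs vs) Rh_s).
transitivity (triangle_op a u (fun d => strip y1 ys gs d (fun d0 s =>
   if d0 == c then at_pos (RbT w) i (fun vs => puzzle_sum ys s hs vs) vs else 0))).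
  apply: finitary_ext (finitary_triangle _ _) _ => d.
  rewrite strip_Rg //; apply: strip_ext => // d0 s ss.
  rewrite (finitary_if (d0 == c) (fun s =>
    at_pos (Rh w) i (fun hs => puzzle_sum (swap_at i ys) s hs vs) hs)
    (finitary_at i s (finitary2_Rg w))).
  by case: ifP => // _; apply: IHi; rewrite ?ss //; apply: generic_behead gen.
have Rb_s := finitary_at i vs (finitary2_RbT w).
rewrite -(finitary_swap (fun d vs => strip y1 ys gs d (fun d0 s =>
  if d0 == c then puzzle_sum ys s hs vs else 0)) (finitary_triangle a u) Rb_s).
apply: finitary_ext (finitary_triangle _ _) _ => d.
rewrite -(finitary2_swap (fun d0 s vs =>
  if d0 == c then puzzle_sum ys s hs vs else 0) (finitary2_strip _ _ _ _) Rb_s).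
apply: finitary2_ext (finitary2_strip _ _ _ _) _ => d0 t.
exact: esym (finitary_if (d0 == c) (fun vs => puzzle_sum ys t hs vs) Rb_s).
Qed.

End Exchange.

(** * Puzzle labellings, one strip at a time *)
Section Finfun.
Variables (R : nmodType) (T : finType).

Definition fcons n (a : T) (f : {ffun 'I_n -> T}) : {ffun 'I_n.+1 -> T} :=
  [ffun i => if unlift ord0 i is Some j then f j else a].

Lemma fcons0 n a (f : {ffun 'I_n -> T}) : fcons a f ord0 = a.
Proof. by rewrite ffunE unlift_none. Qed.

Lemma fconsS n a (f : {ffun 'I_n -> T}) j : fcons a f (lift ord0 j) = f j.
Proof. by rewrite ffunE liftK. Qed.

Lemma big_fcons n (F : {ffun 'I_n.+1 -> T} -> R) :
  \sum_f F f = \sum_a \sum_f F (fcons a f).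
Proof.
rewrite pair_big /= (reindex (fun p => fcons p.1 p.2)) //.
exists (fun f : {ffun _} => (f ord0, [ffun j => f (lift ord0 j)])).
  by move=> [a f] _; rewrite fcons0; congr pair; apply/ffunP=> j; rewrite ffunE fconsS.
move=> f _; apply/ffunP=> i; case: (unliftP ord0 i) => [j|] ->.
  by rewrite fconsS ffunE.
by rewrite fcons0.
Qed.

Lemma big_ffun0 (F : {ffun 'I_0 -> T} -> R) f : \sum_g F g = F f.
Proof.
rewrite (big_pred1 f) // => g; apply/esym/eqP/ffunP => -[] //.
Qed.

End Finfun.

Definition values n T (f : 'I_n -> T) : seq T := [seq f i | i <- enum 'I_n].

Lemma valuesS n T (f : 'I_n.+1 -> T) : values f = f ord0 :: values (fun j => f (lift ord0 j)).
Proof. by rewrite /values enum_ordSl /= -map_comp. Qed.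

Lemma values0 T (f : 'I_0 -> T) : values f = [::].
Proof. by apply: size0nil; rewrite size_map size_enum_ord. Qed.

Lemma size_values n T (f : 'I_n -> T) : size (values f) = n.
Proof. by rewrite size_map size_enum_ord. Qed.

Lemma eq_values n T (f g : 'I_n -> T) : f =1 g -> values f = values g.
Proof. by move=> e; apply: eq_map. Qed.

Section Bij.
Variable n : nat.

Lemma edge0_subproof (j : 'I_n.+1) : ((@ord0 n, j).1 <= (@ord0 n, j).2)%N.
Proof. by []. Qed.
Definition edge0 (j : 'I_n.+1) : edge n.+1 := exist _ (@ord0 n, j) (edge0_subproof j).

Lemma edgeS_subproof (e : edge n) :
  ((lift ord0 (val e).1, lift ord0 (val e).2).1 <= (lift ord0 (val e).1, lift ord0 (val e).2).2)%N.
Proof. exact: (valP e). Qed.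
Definition edgeS (e : edge n) : edge n.+1 := exist _ (_, _) (edgeS_subproof e).

(** The edges of a puzzle of side n.+1 are those on the top sides of the first
    strip and those of the puzzle of side n below it. *)
Definition edge_of (x : 'I_n.+1 + edge n) : edge n.+1 :=
  match x with inl j => edge0 j | inr e => edgeS e end.

Lemma edge_eq m (e e' : edge m) :
  (val e).1 = (val e').1 -> (val e).2 = (val e').2 -> e = e'.
Proof.
move=> h1 h2; apply: val_inj.
by move: h1 h2; case: (val e) => a b; case: (val e') => c d /= -> ->.
Qed.

Lemma edge_of_inj : injective edge_of.
Proof.
move=> x y E.
have {E} [] := (congr1 (fun e => (val e).1) E, congr1 (fun e => (val e).2) E).
case: x y => [i|e] [j|e'] /=; [by move=> _ -> | by move/(congr1 val)..|].
by move=> /lift_inj e1 /lift_inj e2; congr inr; apply: edge_eq.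
Qed.

Lemma edge_of_surj e : e \in codom edge_of.
Proof.
case: (unliftP ord0 (val e).1) => [i|] e1; last first.
  by apply/codomP; exists (inl (val e).2); apply: edge_eq.
case: (unliftP ord0 (val e).2) => [j|] e2; last first.
  by have := valP e; rewrite e1 e2.
have le_ij : ((i, j).1 <= (i, j).2)%N by have := valP e; rewrite e1 e2.
by apply/codomP; exists (inr (exist _ (i, j) le_ij)); apply: edge_eq.
Qed.

Definition edge_of_inv e := iinv (edge_of_surj e).

Lemma edge_of_invK : cancel edge_of_inv edge_of.
Proof. by move=> e; apply: f_iinv. Qed.

Lemma edge_ofK : cancel edge_of edge_of_inv.
Proof. by move=> x; apply: edge_of_inj; apply: edge_of_invK. Qed.

Definition glue (a : {ffun 'I_n.+1 -> label}) (b : {ffun edge n -> label}) :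
  {ffun edge n.+1 -> label} :=
  [ffun e => match edge_of_inv e with inl j => a j | inr e => b e end].

Lemma glue0 a b j : glue a b (edge0 j) = a j.
Proof. by rewrite ffunE -[edge0 j]/(edge_of (inl j)) edge_ofK. Qed.
Lemma glueS a b e : glue a b (edgeS e) = b e.
Proof. by rewrite ffunE -[edgeS e]/(edge_of (inr e)) edge_ofK. Qed.

Lemma edge_ind (P : edge n.+1 -> Prop) :
  (forall j, P (edge0 j)) -> (forall e, P (edgeS e)) -> forall e, P e.
Proof. by move=> P0 PS e; rewrite -(edge_of_invK e); case: (edge_of_inv e). Qed.

Lemma big_glue (R : nmodType) (F : {ffun edge n.+1 -> label} -> R) :
  \sum_g F g = \sum_a \sum_b F (glue a b).
Proof.
rewrite pair_big /= (reindex (fun p => glue p.1 p.2)) //.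
exists (fun g : {ffun _} => ([ffun j => g (edge0 j)], [ffun e => g (edgeS e)])).
  by move=> [a b] _; congr pair; apply/ffunP=> j; rewrite ffunE ?glue0 ?glueS.
by move=> g _; apply/ffunP; apply: edge_ind => j; rewrite ?glue0 ?glueS ffunE.
Qed.

Definition rhombus0 (j : 'I_n) : rhombus n.+1 :=
  exist (fun p : 'I_n.+1 * 'I_n.+1 => (p.1 < p.2)%N) (ord0, lift ord0 j) isT.
Definition rhombusS (r : rhombus n) : rhombus n.+1 :=
  exist (fun p : 'I_n.+1 * 'I_n.+1 => (p.1 < p.2)%N)
    (lift ord0 (val r).1, lift ord0 (val r).2) (valP r).

Lemma rhombus_eq m (r r' : rhombus m) :
  (val r).1 = (val r').1 -> (val r).2 = (val r').2 -> r = r'.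
Proof.
move=> h1 h2; apply: val_inj.
by move: h1 h2; case: (val r) => a b; case: (val r') => c d /= -> ->.
Qed.

Lemma big_rhombus (R : comNzRingType) (F : rhombus n.+1 -> R) :
  \prod_r F r = (\prod_j F (rhombus0 j)) * \prod_r F (rhombusS r).
Proof.
pose u (x : 'I_n + rhombus n) := match x with inl j => rhombus0 j | inr r => rhombusS r end.
have u_inj : injective u.
  move=> x y E.
  have {E} [] := (congr1 (fun e => (val e).1) E, congr1 (fun e => (val e).2) E).
  case: x y => [i|e] [j|e'] /=; [by move=> _ /lift_inj -> | by move/(congr1 val)..|].
  by move=> /lift_inj e1 /lift_inj e2; congr inr; apply: rhombus_eq.
have u_surj r : r \in codom u.
  case: (unliftP ord0 (val r).2) => [j|] e2; last first.
    by have := valP r; rewrite e2.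
  case: (unliftP ord0 (val r).1) => [i|] e1; last first.
    by apply/codomP; exists (inl j); apply: rhombus_eq.
  have lt_ij : ((i, j).1 < (i, j).2)%N by have := valP r; rewrite e1 e2.
  by apply/codomP; exists (inr (exist _ (i, j) lt_ij)); apply: rhombus_eq.
rewrite (reindex u) /=; first by rewrite big_sumType.
exists (fun r => iinv (u_surj r)) => [x|r] _; last exact: f_iinv.
by apply: u_inj; apply: f_iinv.
Qed.

Lemma top_rhombus0 j : top_edge (rhombus0 j) = edge0 (lift ord0 j).
Proof. exact: edge_eq. Qed.
Lemma sw_rhombus0 j : sw_edge (rhombus0 j) = edge0 (widen_ord (leqnSn n) j).
Proof. by apply: edge_eq => //; apply: val_inj. Qed.

Lemma nw_edge_subproof (j : 'I_n) : (0 < n)%N.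
Proof. exact: leq_ltn_trans (ltn_ord j). Qed.
(** The lower edges of the first strip form the north-west side of the puzzle
    below it. *)
Definition nw_edge (j : 'I_n) : edge n :=
  exist (fun p : 'I_n * 'I_n => (p.1 <= p.2)%N)
    (Ordinal (nw_edge_subproof j), j) (leq0n j).

Lemma se_rhombus0 j : se_edge (rhombus0 j) = edgeS (nw_edge j).
Proof. by apply: edge_eq => //; apply: val_inj. Qed.
Lemma top_rhombusS r : top_edge (rhombusS r) = edgeS (top_edge r).
Proof. exact: edge_eq. Qed.
Lemma sw_rhombusS r : sw_edge (rhombusS r) = edgeS (sw_edge r).
Proof.
case: r => -[i j] lt_ij; apply: edge_eq => //; apply: val_inj.
by move: lt_ij; rewrite /= /bump /=; case: (nat_of_ord j).
Qed.
Lemma se_rhombusS r : se_edge (rhombusS r) = edgeS (se_edge r).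
Proof. by apply: edge_eq => //; apply: val_inj. Qed.
Lemma diag0 : diag_edge (@ord0 n) = edge0 ord0.
Proof. exact: edge_eq. Qed.
Lemma diagS i : diag_edge (lift ord0 i) = edgeS (diag_edge i).
Proof. exact: edge_eq. Qed.

Definition nw_side m (l : 'I_m -> label) (g : {ffun edge m -> label}) :=
  [forall e : edge m, ((val e).1 == 0%N :> nat) ==> (g e == l (val e).2)].
Definition ne_side m (l : 'I_m -> label) (h : {ffun edge m -> label}) :=
  [forall e : edge m, ((val e).2 == m.-1 :> nat) ==> (h e == l (val e).1)].

Lemma nw_glue (l : 'I_n.+1 -> label) a b : nw_side l (glue a b) = (a == [ffun j => l j]).
Proof.
apply/forallP/eqP => [h|-> e].
  by apply/ffunP=> j; have := h (edge0 j); rewrite glue0 ffunE /= => /eqP.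
by elim/edge_ind: e => e; rewrite ?glue0 ?ffunE //= eqxx.
Qed.

Lemma nw_side_edge (s : {ffun 'I_n -> label}) b :
  nw_side s b = ([ffun j => b (nw_edge j)] == s).
Proof.
apply/forallP/eqP => [h|<- e].
  by apply/ffunP=> j; rewrite ffunE; have := h (nw_edge j); rewrite /= => /eqP.
apply/implyP=> /eqP e0; rewrite ffunE; apply/eqP; congr (b _).
by apply: edge_eq => //; apply: val_inj.
Qed.

Lemma ne_glue (m : 'I_n.+1 -> label) a b :
  ne_side m (glue a b) = (a ord_max == m ord0) && ne_side (fun j => m (lift ord0 j)) b.
Proof.
apply/forallP/andP => [h|[h0 /forallP h] e].
  split; first by have := h (edge0 ord_max); rewrite glue0 /= eqxx.
  apply/forallP=> e; have := h (edgeS e); rewrite glueS /= /bump /= add1n.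
  apply: contraTT; rewrite !negb_imply => /andP[/eqP ->] ->; rewrite andbT.
  by have := ltn_ord (val e).1; lia.
elim/edge_ind: e => e; rewrite ?glue0 ?glueS /=.
  apply/implyP=> /eqP en; rewrite -(eqP h0); apply/eqP; congr (a _).
  exact: val_inj.
have := h e; rewrite /bump /= add1n; apply: contraTT.
rewrite !negb_imply => /andP[/eqP en] ->; rewrite andbT.
by apply/eqP; have := congr1 predn en.
Qed.

End Bij.

Section Sum.
Variables (K : fieldType) (q Q : K).
Local Notation cross := (cross q Q).
Local Notation triangle_op := (@triangle_op K).
Local Notation strip := (strip q Q).
Local Notation puzzle_sum := (puzzle_sum q Q).

(** Matrix coefficients of [cross] and [triangle_op]. *)
Definition rhombus_wt z (nw ne sw se : label) : K :=
  cross z sw nw (fun x y => ((x == ne) && (y == se))%:R).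
Definition triangle_wt (nw : label) v ne : K := triangle_op nw v (fun x => (x == ne)%:R).

Lemma rhombus_wtE z nw ne sw se : rhombus_wt z nw ne sw se =
  let a := Q - q ^+ 2 in let E := Q - q ^+ 2 * z in
  match nw, ne, sw, se with
  | L0, L0, L0, L0 | L1, L1, L1, L1 | L1, L0, L0, L1
  | L10, L1, L1, L10 | L0, L10, L10, L0 => 1
  | L10, L10, L10, L10 => Q
  | L0, L0, L1, L10 | L1, L1, L10, L0 => a / E
  | L0, L10, L1, L1 | L10, L1, L0, L0 => a * z / E
  | L0, L1, L1, L0 => q * (1 - z) / E
  | L10, L0, L0, L10 | L1, L10, L10, L1 => q * Q * (1 - z) / E
  | L1, L0, L10, L10 => - (q * a / E)
  | L10, L10, L0, L1 => - (a * Q * z / (q * E))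
  | _, _, _, _ => 0
  end.
Proof.
by case: nw; case: ne; case: sw; case: se;
  rewrite /rhombus_wt /cross /den /= ?(mulr0, mulr1, addr0, add0r).
Qed.

Lemma finitary_kernel (T : finType) (Phi : (T -> K) -> K) F :
  finitary Phi -> Phi F = \sum_x Phi (fun y => (y == x)%:R) * F x.
Proof.
case=> r rE; rewrite [LHS]rE; under [RHS]eq_bigr => x _ do rewrite rE mulr_suml.
rewrite [RHS]exchange_big /=; apply: eq_bigr => t _.
rewrite (bigD1 t.2) //= eqxx mulr1 big1 ?addr0 // => x nx.
by rewrite eq_sym (negPf nx) mulr0 mul0r.
Qed.

Lemma cross_sum z d g F :
  cross z d g F = \sum_x \sum_y rhombus_wt z g x d y * F x y.
Proof.
rewrite pair_big /=.
have := finitary_kernel (fun p => F p.1 p.2) (finitary2_cross q Q z d g) => /= ->.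
by apply: eq_bigr.
Qed.

Lemma triangle_op_sum g v F : triangle_op g v F = \sum_x triangle_wt g v x * F x.
Proof. exact: finitary_kernel (finitary_triangle _ _ _). Qed.

Lemma strip_sum n y1 (ys : 'I_n -> K) (g : 'I_n -> label)
   (T : label -> K) (F : label -> seq label -> K) :
  \sum_(h : {ffun 'I_n.+1 -> label}) \sum_(s : {ffun 'I_n -> label})
    T (h ord0) *
    (\prod_(j < n) rhombus_wt (ys j / y1) (g j)
       (h (lift ord0 j)) (h (widen_ord (leqnSn n) j)) (s j))
    * F (h ord_max) (values s)
  = \sum_d T d * strip y1 (values ys) (values g) d F.
Proof.
elim: n ys g T F => [|n IHn] ys g T F.
  rewrite big_fcons; apply: eq_bigr => d _.
  rewrite (big_ffun0 _ [ffun _ => d]) (big_ffun0 _ [ffun _ => d]) big_ord0 mulr1.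
  have -> : ord_max = @ord0 0 by apply: val_inj.
  by rewrite fcons0 !values0.
rewrite big_fcons; apply: eq_bigr => d _.
rewrite !valuesS /= cross_sum mulr_sumr.
transitivity (\sum_s0 \sum_x (T d * rhombus_wt (ys ord0 / y1) (g ord0) x d s0) *
   strip y1 (values (fun j => ys (lift ord0 j))) (values (fun j => g (lift ord0 j))) x
    (fun d0 s => F d0 (s0 :: s))).
  rewrite exchange_big big_fcons; apply: eq_bigr => s0 _.
  rewrite -(IHn _ _ (fun x => T d * rhombus_wt (ys ord0 / y1) (g ord0) x d s0)) exchange_big.
  apply: eq_bigr => h _; apply: eq_bigr => s _.
  rewrite big_ord_recl fcons0 valuesS fcons0 !mulrA.
  have -> : widen_ord (leqnSn n.+1) ord0 = ord0 by apply: val_inj.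
  have -> : ord_max = lift ord0 (@ord_max n) by apply: val_inj.
  rewrite fcons0 !fconsS; congr (_ * _ * F _ (_ :: _)).
    apply: eq_bigr => j _; rewrite !fconsS; congr (rhombus_wt _ _ _ _ _).
    have -> : widen_ord (leqnSn n.+1) (lift ord0 j) = lift ord0 (widen_ord (leqnSn n) j).
      exact: val_inj.
    by rewrite fconsS.
  by apply: eq_values => j; rewrite fconsS.
rewrite exchange_big; apply: eq_bigr => x _; rewrite mulr_sumr.
by apply: eq_bigr => s0 _; rewrite mulrA.
Qed.

(** Both sides carry arbitrary labels: below the first strip the label 10 may
    appear on the north-west side. *)
Definition labelling_sum n (ys : 'I_n -> K) (l m : 'I_n -> label) (u : 'I_n -> bool) : K :=
  \sum_(g | nw_side l g) \sum_(h | ne_side m h)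
    (\prod_(r : rhombus n) rhombus_wt (ys (val r).2 / ys (val r).1)
       (g (top_edge r)) (h (top_edge r)) (h (sw_edge r)) (g (se_edge r)))
    * \prod_(i < n) triangle_wt (g (diag_edge i)) (u i) (h (diag_edge i)).

(** The sum factors over the labels of the edges in the first strip, given the
    labels s of the north-west side of the puzzle below it. *)
Lemma labelling_sumE n (ys : 'I_n -> K) (l m : 'I_n -> label) (u : 'I_n -> bool) :
  labelling_sum ys l m u = puzzle_sum (values ys) (values l) (values m) (values u).
Proof.
elim: n ys l m u => [|n IHn] ys l m u.
  rewrite !values0 /labelling_sum /=.
  have noE (e : edge 0) : False by case: e => -[[]].
  have nw1 g : nw_side l g by apply/forallP.
  have ne1 g : ne_side m g by apply/forallP.
  pose g0 : {ffun edge 0 -> label} := [ffun _ => L0].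
  have all_g0 g : g == g0 by apply/eqP/ffunP.
  rewrite (big_pred1 g0) => [|g]; last by rewrite nw1 /= all_g0.
  rewrite (big_pred1 g0) => [|g]; last by rewrite ne1 /= all_g0.
  by rewrite big_ord0 mulr1 big1 // => r; case: r => -[[]].
rewrite !valuesS /= triangle_op_sum -strip_sum /labelling_sum.
rewrite big_mkcond big_glue (bigD1 [ffun j => l j]) //= [X in _ + X]big1 => [|a na]; last first.
  by apply: big1 => b _; rewrite nw_glue (negPf na).
rewrite addr0 (partition_big (fun b : {ffun edge n -> label} => [ffun j => b (nw_edge j)]) predT) //=.
rewrite [RHS]exchange_big; apply: eq_bigr => s _.
transitivity (\sum_(a : {ffun 'I_n.+1 -> label}) \sum_(b | nw_side s b)
   if a ord_max == m ord0 then
    \sum_(b' | ne_side (fun j => m (lift ord0 j)) b')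
    triangle_wt (l ord0) (u ord0) (a ord0) *
    (\prod_(j < n) rhombus_wt (ys (lift ord0 j) / ys ord0) (l (lift ord0 j))
       (a (lift ord0 j)) (a (widen_ord (leqnSn n) j)) (s j)) *
    ((\prod_(r : rhombus n) rhombus_wt (ys (lift ord0 (val r).2) / ys (lift ord0 (val r).1))
       (b (top_edge r)) (b' (top_edge r)) (b' (sw_edge r)) (b (se_edge r)))
    * \prod_(i < n) triangle_wt (b (diag_edge i)) (u (lift ord0 i)) (b' (diag_edge i))) else 0).
  rewrite exchange_big; apply: eq_big => [b|b /eqP bs]; first by rewrite nw_side_edge.
  rewrite nw_glue eqxx big_mkcond big_glue; apply: eq_bigr => a _.
  under eq_bigr => b' _ do rewrite ne_glue.
  case: ifP => _ /=; last by rewrite big1.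
  rewrite [RHS]big_mkcond; apply: eq_bigr => b' _; case: ifP => // _.
  rewrite big_rhombus big_ord_recl diag0 !glue0 ffunE.
  rewrite mulrACA [_ * triangle_wt _ _ _]mulrC; congr (_ * _ * (_ * _)).
  - apply: eq_bigr => j _; rewrite top_rhombus0 sw_rhombus0 se_rhombus0 !glue0 glueS ffunE.
    by rewrite -bs ffunE.
  - by apply: eq_bigr => r _; rewrite top_rhombusS sw_rhombusS se_rhombusS !glueS.
  - by apply: eq_bigr => i _; rewrite diagS !glueS.
apply: eq_bigr => a _; case: ifP => _; last by rewrite big1 ?mulr0.
rewrite -IHn mulr_sumr; apply: eq_bigr => b _.
by rewrite mulr_sumr.
Qed.

End Sum.

(** * Puzzles under field morphisms and with a sorted bottom side *)
Section Morph.
Variables (K : fieldType) (q Q : K) (f : {rmorphism K -> K}).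

Lemma cross_morph z d g F :
  f (cross q Q z d g F) = cross (f q) (f Q) (f z) d g (fun x y => f (F x y)).
Proof.
by case: d; case: g; rewrite /cross /den //=
  ?(rmorphD, rmorphB, rmorphN, rmorphM, fmorphV, rmorphXn, rmorph1).
Qed.

Lemma strip_morph y1 ys gs d F :
  f (strip q Q y1 ys gs d F)
  = strip (f q) (f Q) (f y1) [seq f y | y <- ys] gs d (fun x s => f (F x s)).
Proof.
elim: ys gs d F => [|y ys IHy] [|g gs] d F //=.
rewrite cross_morph rmorphM fmorphV.
by apply: (finitary2_ext (finitary2_cross _ _ _ _ _)) => d' g'; apply: IHy.
Qed.

Lemma puzzle_sum_morph ys gs hs vs :
  f (puzzle_sum q Q ys gs hs vs) = puzzle_sum (f q) (f Q) [seq f y | y <- ys] gs hs vs.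
Proof.
elim: ys gs hs vs => [|y ys IHy] [|g gs] [|h hs] [|v vs] //=; rewrite ?rmorph1 //.
have -> F : f (triangle_op g v F) = triangle_op g v (fun x => f (F x)).
  by case: g; case: v; rewrite /= ?rmorph0.
apply: (finitary_ext (finitary_triangle _ _ _)) => d; rewrite strip_morph.
apply: (finitary2_ext (finitary2_strip _ _ _ _ _ _)) => d0 s.
by case: ifP; rewrite ?rmorph0.
Qed.

End Morph.

Section Top.
Variables (K : fieldType) (q Q : K).

Lemma strip_letter0 y1 (ys : seq K) (l : seq bool) F : size l = size ys ->
  strip q Q y1 ys (map letter l) L0 F = F L0 (map letter l).
Proof.
elim: ys l F => [|y ys IHy] [|[] l] F //= [sz]; rewrite IHy //.
Qed.

Lemma strip_ones y1 (ys : seq K) F :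
  strip q Q y1 ys (nseq (size ys) L1) L1 F = F L1 (nseq (size ys) L1).
Proof. by elim: ys F => [|y ys IHy] F //=; rewrite IHy. Qed.

Lemma letter_eq (a b : bool) : (letter a == letter b) = (a == b).
Proof. by case: a; case: b. Qed.

Lemma count_nseq_true b (l : seq bool) : size l = b -> count id l = b -> l = nseq b true.
Proof.
move=> <- /eqP; rewrite -all_count => /allP ones.
by apply/all_pred1P/allP => x /ones /= ->.
Qed.

(** If a strip ends in 0 and all g lines carry letters, then each of its rhombi
    is forced to have NE label 0 and fugacity 1, and it leaves the g lines
    unchanged.  So every bottom label 0 removes a 0 from both sides; what
    remains is a puzzle with only 1 on all sides, which is rigid as well. *)
Lemma puzzle_sum_top a b (ys : seq K) (l m : seq bool) :
  size ys = (a + b)%N -> size l = (a + b)%N -> size m = (a + b)%N ->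
  count id l = b -> count id m = b ->
  let top := nseq a false ++ nseq b true in
  puzzle_sum q Q ys (map letter l) (map letter m) top = ((l == top) && (m == top))%:R.
Proof.
elim: a ys l m => [|a IHa] ys l m sy qS sm cl cm /=.
  have -> : l = nseq b true by exact: count_nseq_true.
  have -> : m = nseq b true by exact: count_nseq_true.
  rewrite !eqxx map_nseq; elim: b ys {qS sm cl cm} sy => [|b IHb] [|y ys] //= [sy].
  by rewrite -[b]sy strip_ones eqxx sy IHb.
case: ys l m sy qS sm cl cm => [|y ys] [|x l] [|x' m] //= [sy] [qS] [sm] cl cm.
case: x cl => cl //=.
rewrite strip_letter0; last by rewrite qS.
rewrite eqseq_cons [x' :: m == _]eqseq_cons -[L0]/(letter false) letter_eq eq_sym.
case: x' cm => cm /=; first by rewrite andbF.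
by rewrite IHa.
Qed.

End Top.

(** * Fugacities *)
Section Fug.
Variable n : nat.

Lemma bb_QQ : bb n * (1 - qq n ^+ 2) = QQ n - qq n ^+ 2.
Proof. by rewrite /QQ; ring. Qed.

Lemma rhombus_fugE z nw ne sw se :
  odflt 0 (rhombus_fug z nw ne sw se) = rhombus_wt (qq n) (QQ n) z nw ne sw se.
Proof.
rewrite /rhombus_fug bb_QQ.
rewrite rhombus_wtE; case: nw; case: ne; case: sw; case: se; reflexivity.
Qed.

Lemma triangle_fugE nw v ne :
  odflt 0 (triangle_fug n nw (letter v) ne) = triangle_wt (FracB n) nw v ne.
Proof. by case: nw; case: v; case: ne. Qed.

(** A labelling with a forbidden tile has a factor 0, so the two conditions on
    tiles may be dropped from the range of the sum. *)
Lemma sum_fug (l m u : word n) :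
  \sum_(P | is_puzzle l m u P) fug P
  = labelling_sum (qq n) (QQ n) (@ey n) (fun i => letter (l i)) (fun i => letter (m i)) u.
Proof.
pose b0 : {ffun 'I_n -> label} := [ffun i => letter (u i)].
pose ok (P : labelling n) := [&& nw_side (fun i => letter (l i)) P.1.1,
  ne_side (fun i => letter (m i)) P.1.2 & P.2 == b0].
transitivity (\sum_(P | ok P) fug P).
  rewrite [LHS]big_mkcond [RHS]big_mkcond; apply: eq_bigr => P _.
  have -> : is_puzzle l m u P = [&& ok P, [forall r, rhombus_at P r : bool]
    & [forall i, triangle_at P i : bool]].
    rewrite /is_puzzle /ok -!andbA; congr [&& _, _ & _].
    have -> // : [forall i, blab P i == letter (u i)] = (P.2 == b0).
    apply/forallP/eqP => [h|h i]; last by rewrite /blab h ffunE.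
    by apply/ffunP=> i; rewrite ffunE; apply/eqP/h.
  case: (ok P) => //=; case: ifP => // /negbT; rewrite negb_and /fug.
  by case/orP => /forallPn[i]; [rewrite [X in X * _](bigD1 i)//= | rewrite [X in _ * X](bigD1 i) //=];
    case: (_ P i) => //= _; rewrite !(mul0r, mulr0).
rewrite (reindex_onto (fun p => (p, b0)) (fun P => P.1)) /=; last first.
  by case=> [[g h] b] /and3P[_ _ /eqP /= ->].
rewrite /labelling_sum pair_big_dep /=; apply: eq_big => [[g h]|[g h] _] /=.
  by rewrite /ok /= !eqxx !andbT.
rewrite /fug; congr (_ * _); apply: eq_bigr => i _.
  by rewrite /rhombus_at rhombus_fugE.
by rewrite /triangle_at /blab /= ffunE triangle_fugE.
Qed.

End Fug.

(** * Words, inversions and simple reflections *)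
Section Words.
Variable n : nat.
Implicit Types (i j : 'I_n.-1) (l m : word n).

Definition wrefl i l : word n := [ffun p => l (refl i p)].

Lemma wrefl_actw i l : actw (refl i) l = wrefl i l.
Proof. by apply/ffunP=> p; rewrite !ffunE tpermV. Qed.

Lemma wreflK i : involutive (wrefl i).
Proof. by move=> l; apply/ffunP=> p; rewrite !ffunE tpermK. Qed.

Lemma wrefl_lo i l : wrefl i l (rlo i) = l (rhi i).
Proof. by rewrite ffunE tpermL. Qed.
Lemma wrefl_hi i l : wrefl i l (rhi i) = l (rlo i).
Proof. by rewrite ffunE tpermR. Qed.
Lemma wrefl_other i l p : p != rlo i -> p != rhi i -> wrefl i l p = l p.
Proof. by move=> h1 h2; rewrite ffunE tpermD // eq_sym. Qed.

Lemma wrefl_id i l : l (rlo i) = l (rhi i) -> wrefl i l = l.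
Proof. by move=> e; apply/ffunP=> p; rewrite ffunE; case: tpermP => // ->. Qed.

Lemma lo_neq_hi i : rlo i != rhi i.
Proof. by rewrite -val_eqE /=; lia. Qed.

Lemma adj_neq i j : i.+1 = j :> nat ->
  [/\ rhi i = rlo j, rlo i != rlo j & rlo i != rhi j].
Proof.
move=> ij; split; first by apply: val_inj; rewrite /= ij.
  by rewrite -val_eqE /=; lia.
by rewrite -val_eqE /=; lia.
Qed.

Lemma far_neq i j : (i.+1 < j)%N || (j.+1 < i)%N ->
  [/\ rlo j != rlo i, rlo j != rhi i, rhi j != rlo i & rhi j != rhi i].
Proof. by rewrite -!val_eqE /= => ij; split; lia. Qed.

Lemma reflE i a : refl i a = if a == rlo i then rhi i else if a == rhi i then rlo i else a.
Proof. by rewrite /refl permE. Qed.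

Lemma refl_fix i a : a != rlo i -> a != rhi i -> refl i a = a.
Proof. by move=> h1 h2; rewrite reflE (negPf h1) (negPf h2). Qed.

Lemma refl_adj_l i j : i.+1 = j :> nat ->
  [/\ refl i (rlo i) = rlo j, refl i (rlo j) = rlo i & refl i (rhi j) = rhi j].
Proof.
move=> ij; have [e n2 n1] := adj_neq ij; split.
- by rewrite -e /refl tpermL.
- by rewrite -e /refl tpermR.
by apply: refl_fix; rewrite ?e eq_sym // lo_neq_hi.
Qed.

Lemma refl_adj_r i j : i.+1 = j :> nat ->
  [/\ refl j (rlo i) = rlo i, refl j (rlo j) = rhi j & refl j (rhi j) = rlo j].
Proof.
move=> ij; have [_ n2 n1] := adj_neq ij; split; first exact: refl_fix.
- by rewrite /refl tpermL.
- by rewrite /refl tpermR.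
Qed.

Lemma refl_comm i j a : (i.+1 < j)%N -> refl i (refl j a) = refl j (refl i a).
Proof.
move=> ij; have [|e1 e2 e3 e4] := @far_neq i j; first by rewrite ij.
have [f1 f2] : refl i (rlo j) = rlo j /\ refl i (rhi j) = rhi j by rewrite !refl_fix.
have [g1 g2] : refl j (rlo i) = rlo i /\ refl j (rhi i) = rhi i.
  by rewrite !refl_fix // eq_sym.
have [->|i1] := eqVneq a (rlo i); first by rewrite g1 /refl tpermL -/(refl j) g2.
have [->|i2] := eqVneq a (rhi i); first by rewrite g2 /refl tpermR -/(refl j) g1.
have [->|j1] := eqVneq a (rlo j); first by rewrite f1 /refl tpermL -/(refl i) f2.
have [->|j2] := eqVneq a (rhi j); first by rewrite f2 /refl tpermR -/(refl i) f1.
by rewrite !refl_fix.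
Qed.

Lemma refl_braid i j a : i.+1 = j :> nat ->
  refl i (refl j (refl i a)) = refl j (refl i (refl j a)).
Proof.
move=> ij; have [e _ _] := adj_neq ij.
have [l1 l2 l3] := refl_adj_l ij; have [r1 r2 r3] := refl_adj_r ij.
have [->|a1] := eqVneq a (rlo i); first by rewrite !(l1, l2, l3, r1, r2, r3).
have [->|a2] := eqVneq a (rlo j); first by rewrite !(l1, l2, l3, r1, r2, r3).
have [->|a3] := eqVneq a (rhi j); first by rewrite !(l1, l2, l3, r1, r2, r3).
have fi : refl i a = a by rewrite refl_fix ?e.
have fj : refl j a = a by rewrite refl_fix.
by rewrite !(fi, fj).
Qed.

Lemma wrefl_comm i j m : (i.+1 < j)%N -> wrefl i (wrefl j m) = wrefl j (wrefl i m).
Proof. by move=> ij; apply/ffunP=> a; rewrite !ffunE (refl_comm _ ij). Qed.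

Lemma wrefl_braid i j m : i.+1 = j :> nat ->
  wrefl i (wrefl j (wrefl i m)) = wrefl j (wrefl i (wrefl j m)).
Proof. by move=> ij; apply/ffunP=> a; rewrite !ffunE (refl_braid _ ij). Qed.

(** How two simple reflections interact: equal, commuting, or braided in one of
    the two orders. *)
Variant dist_spec i j : Prop :=
  | DistEq of i = j
  | DistFar of (i.+1 < j)%N || (j.+1 < i)%N
  | DistUp of i.+1 = j :> nat
  | DistDown of j.+1 = i :> nat.

Lemma distP i j : dist_spec i j.
Proof.
have [->|ij] := eqVneq i j; first exact: DistEq.
have [far|] := boolP ((i.+1 < j)%N || (j.+1 < i)%N); first exact: DistFar.
have [e|ne] := eqVneq i.+1 j; first by move=> _; apply: DistUp.
by move=> far; apply: DistDown; move: ij far ne; rewrite -val_eqE /=; lia.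
Qed.

Definition isinv l (p : 'I_n * 'I_n) := (p.1 < p.2)%N && (l p.2 < l p.1)%N.

Definition refl2 i (p : 'I_n * 'I_n) := (refl i p.1, refl i p.2).

Lemma refl2K i : involutive (refl2 i).
Proof. by case=> a b; rewrite /refl2 /= !tpermK. Qed.

Lemma refl_lt i (a b : 'I_n) : a != b ->
  (a, b) != (rlo i, rhi i) -> (a, b) != (rhi i, rlo i) ->
  (refl i a < refl i b)%N = (a < b)%N.
Proof.
rewrite !xpair_eqE => ab h1 h2.
rewrite /refl; case: tpermP => [ea|ea|/eqP a1 /eqP a2];
  case: tpermP => [eb|eb|/eqP b1 /eqP b2] //;
  move: h1 h2 ab; rewrite ?ea ?eb ?eqxx //=.
all: try (move: a1 a2); try (move: b1 b2); rewrite -!val_eqE /=; lia.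
Qed.

Lemma isinv_wrefl_same i l p : l (rlo i) = l (rhi i) ->
  isinv l (refl2 i p) = isinv l p.
Proof.
case: p => a b e; rewrite /isinv /=.
have rl c : l (refl i c) = l c by rewrite -{2}(wrefl_id e) ffunE.
rewrite !rl; case: (ltnP (l b) (l a)); rewrite ?andbF // !andbT => lt_ba.
apply: refl_lt.
- by apply: contraTneq lt_ba => ->; rewrite ltnn.
- by apply: contraTneq lt_ba => -[-> ->]; rewrite e ltnn.
- by apply: contraTneq lt_ba => -[-> ->]; rewrite e ltnn.
Qed.

(** If l reads 01 at i, i+1 then r_i carries the inversions of l onto those of
    r_i l except the new one at i, i+1.  The law is arbitrary because the
    inversions are counted as well as multiplied. *)
Lemma big_isinv R idx (op : Monoid.com_law idx) (F : 'I_n * 'I_n -> R) i l :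
  ~~ l (rlo i) -> l (rhi i) ->
  \big[op/idx]_(p | isinv (wrefl i l) p) F (refl2 i p)
  = op (F (rhi i, rlo i)) (\big[op/idx]_(p | isinv l p) F p).
Proof.
move=> /negbTE l0 l1.
rewrite (reindex_inj (inv_inj (refl2K i))) /= (bigD1 (rhi i, rlo i)) /=; last first.
  by rewrite /isinv /= !ffunE /refl !(tpermL, tpermR) l0 l1 andbT /= ltnSn.
rewrite refl2K; congr (op _ _); apply: eq_big => [[a b]|p _]; last by rewrite refl2K.
rewrite /isinv /= !ffunE !tpermK.
case: (ltnP (l b) (l a)); rewrite ?andbF //= !andbT => lt_ba.
have [[-> ->]|ne] := eqVneq (a, b) (rhi i, rlo i); first by rewrite andbF /= ltnNge leqnSn.
rewrite andbT; apply: refl_lt => //.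
- by apply: contraTneq lt_ba => ->; rewrite ltnn.
- by apply: contraTneq lt_ba => -[-> ->]; rewrite l0 l1.
Qed.

Lemma ellE l : ell l = (\sum_(p | isinv l p) 1)%N.
Proof. by rewrite /ell -sum1_card; apply: eq_bigl => p; rewrite inE. Qed.

Lemma ell_wrefl i l : ~~ l (rlo i) -> l (rhi i) -> ell (wrefl i l) = (ell l).+1.
Proof.
move=> l0 l1; rewrite !ellE.
exact: (@big_isinv _ _ addn (fun _ => 1%N) i l l0 l1).
Qed.

Definition rise i l := ~~ l (rlo i) && l (rhi i).

Lemma ell_rise i l : rise i l -> ell (wrefl i l) = (ell l).+1.
Proof. by case/andP; apply: ell_wrefl. Qed.

Lemma rise_wrefl i l : rise i (wrefl i l) = l (rlo i) && ~~ l (rhi i).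
Proof. by rewrite /rise wrefl_lo wrefl_hi andbC. Qed.

Lemma ell_cases i l : [\/ wrefl i l = l, rise i l /\ ell (wrefl i l) = (ell l).+1
   | rise i (wrefl i l) /\ ell l = (ell (wrefl i l)).+1].
Proof.
case lo: (l (rlo i)); case hi: (l (rhi i)).
- by constructor 1; rewrite wrefl_id ?lo ?hi.
- have r : rise i (wrefl i l) by rewrite rise_wrefl lo hi.
  by constructor 3; split=> //; rewrite -{1}(wreflK i l) (ell_rise r).
- have r : rise i l by rewrite /rise lo hi.
  by constructor 2; split=> //; apply: ell_rise.
- by constructor 1; rewrite wrefl_id ?lo ?hi.
Qed.

Lemma ell_lt_rise i l : (ell l < ell (wrefl i l))%N -> rise i l.
Proof. by case: (ell_cases i l) => [->|[]|[_ ->]]; rewrite ?ltnn //; lia. Qed.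

Lemma ell_wrefl_le i l : (ell (wrefl i l) <= (ell l).+1)%N.
Proof. by case: (ell_cases i l) => [->|[_ ->]|[_ ->]]; lia. Qed.

Definition ones l := #|[set p | l p]|.

Lemma ones_wrefl i l : ones (wrefl i l) = ones l.
Proof.
rewrite /ones -[RHS](card_imset _ (@perm_inj _ (refl i))); apply: eq_card => p.
rewrite !inE ffunE; apply/idP/imsetP => [h|[x]].
  by exists (refl i p); rewrite ?inE // tpermK.
by rewrite inE => h ->; rewrite tpermK.
Qed.

Lemma adjacent_rel (P : rel bool) l :
  reflexive P -> transitive P ->
  (forall i, P (l (rlo i)) (l (rhi i))) ->
  forall a b : 'I_n, (a <= b)%N -> P (l a) (l b).
Proof.
move=> Pr Pt step a [b ltb] /= le_ab.
elim: b ltb le_ab => [|b IHb] ltb.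
  by move=> le; have -> : a = Ordinal ltb by apply: val_inj => /=; lia.
rewrite leq_eqVlt => /orP[/eqP e|le_ab].
  by have -> : a = Ordinal ltb by apply: val_inj.
apply: Pt (IHb (ltnW ltb) le_ab) _.
have ltb1 : (b < n.-1)%N by lia.
have := step (Ordinal ltb1).
have -> : rlo (Ordinal ltb1) = Ordinal (ltnW ltb) by apply: val_inj.
by have -> : rhi (Ordinal ltb1) = Ordinal ltb by apply: val_inj.
Qed.

Lemma card_below a : (a <= n)%N -> #|[set p : 'I_n | (p < a)%N]| = a.
Proof.
move=> le_an; rewrite -sum1_card; under eq_bigl => p do rewrite inE.
by rewrite -(big_ord_widen n (fun _ => 1%N) le_an) sum_nat_const card_ord muln1.
Qed.

Lemma ones_le l : (ones l <= n)%N.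
Proof. by rewrite -[leqRHS](card_ord n) max_card. Qed.

Lemma no_rise_w0 l : (forall i, ~~ rise i l) -> l = w0 n (ones l).
Proof.
move=> nr.
have dec := @adjacent_rel (fun a b => b ==> a) l implybb
  (fun b a c h1 h2 => introT implyP (fun hc => implyP h1 (implyP h2 hc))).
have {}dec (a b : 'I_n) : (a <= b)%N -> l b -> l a.
  move=> ab; apply/implyP; apply: dec ab => i; have := nr i.
  by rewrite /rise negb_and negbK implybE orbC.
have sub : [set p | l p] \subset [set p : 'I_n | (p < ones l)%N].
  apply/subsetP=> p; rewrite !inE => lp.
  rewrite -[p.+1](card_below (ltn_ord p)) /ones; apply/subset_leq_card/subsetP => a.
  by rewrite !inE ltnS => ap; apply: dec lp.
have /eqP/setP eqA : [set p | l p] == [set p : 'I_n | (p < ones l)%N].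
  by rewrite eqEcard sub card_below ?ones_le // leqnn.
by apply/ffunP=> p; have := eqA p; rewrite !inE ffunE.
Qed.

Lemma no_drop_monotone l : (forall i, ~~ rise i (wrefl i l)) ->
  forall a b : 'I_n, (a <= b)%N -> l a -> l b.
Proof.
move=> nr a b ab; apply/implyP.
apply: (@adjacent_rel (fun a b => a ==> b) l) ab; first exact: implybb.
  by move=> y x z /implyP h1 /implyP h2; apply/implyP=> /h1.
by move=> i; have := nr i; rewrite rise_wrefl negb_and negbK implybE.
Qed.

Lemma ell_gt0 l : (0 < ell l)%N -> exists i, rise i (wrefl i l).
Proof.
move=> l0; apply/existsP; apply: contraTT l0; rewrite negb_exists => /forallP nr.
rewrite lt0n negbK ellE big1 // => -[a b] /andP[/= ab].
by have := no_drop_monotone nr (ltnW ab); case: (l a) => // ->.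
Qed.

Lemma ell_le l : (ell l <= n * n)%N.
Proof.
by apply: leq_trans (max_card _) _; rewrite card_prod card_ord.
Qed.

End Words.

(** * Climbing from w_0 to a word *)
Section Climb.
Variables (n k : nat).
Implicit Types (i j : 'I_n.-1) (l m : word n) (s t : seq 'I_n.-1).

(** The reflections of s, applied from right to left, lead from w_0 to l, each
    of them turning 10 into 01. *)
Fixpoint climb s l : bool :=
  if s is i :: s' then rise i l && climb s' (wrefl i l) else l == w0 n k.

Lemma climb_size s l : climb s l -> (size s + ell l)%N = ell (w0 n k).
Proof.
elim: s l => [|i s IHs] l /=; first by move=> /eqP ->.
by case/andP=> r /IHs; rewrite (ell_rise r) addSnnS.
Qed.

Lemma climb_size_eq s t l : climb s l -> climb t l -> size s = size t.
Proof. by move=> /climb_size e /climb_size; rewrite -e => /addIn. Qed.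

Lemma ex_climb l : ones l = k -> exists s, climb s l.
Proof.
move Ed: (n * n - ell l)%N => d.
elim/ltn_ind: d l Ed => d IHd l Ed lk.
have [/existsP[i r]|/existsPn nr] := boolP [exists i, rise i l].
  have [|||s cs] := IHd (n * n - ell (wrefl i l))%N _ (wrefl i l) => //.
  - by have := ell_le (wrefl i l); have := ell_rise r; lia.
  - by rewrite ones_wrefl.
  by exists (i :: s); rewrite /= r.
by exists [::]; rewrite /= -lk; apply/eqP/no_rise_w0.
Qed.

Lemma isinv_w0 p : isinv (w0 n k) p = (p.1 < k <= p.2)%N.
Proof. by rewrite /isinv /w0 !ffunE; lia. Qed.

Lemma w0_norise i : rise i (w0 n k) = false.
Proof. by rewrite /rise !ffunE /=; lia. Qed.

(** A simple reflection lowers [ell] by at most one. *)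
Lemma ell_word s : (ell (w0 n k) <= size s + ell (actw (word_perm s) (w0 n k)))%N.
Proof.
elim: s => [|i s IHs] /=.
  rewrite add0n; apply: eq_leq; congr ell; apply/ffunP=> p.
  by rewrite [RHS]ffunE invg1 perm1.
set l := actw (word_perm s) _ in IHs.
have -> : actw (word_perm s * refl i) (w0 n k) = wrefl i l.
  by apply/ffunP=> p; rewrite !ffunE invMg permM tpermV.
by have := ell_wrefl_le i (wrefl i l); rewrite wreflK; lia.
Qed.

(** By [ell_word] there is no room for a reflection that does not lower [ell]. *)
Lemma short_climb s l : actw (word_perm s) (w0 n k) = l ->
  (size s + ell l <= ell (w0 n k))%N -> climb s l.
Proof.
elim: s l => [|i s IHs] l /=.
  move=> <- _; apply/eqP/ffunP=> p; by rewrite [LHS]ffunE invg1 perm1.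
set l' := actw (word_perm s) (w0 n k).
have -> : actw (word_perm s * refl i) (w0 n k) = wrefl i l'.
  by apply/ffunP=> p; rewrite !ffunE invMg permM tpermV.
move=> <- sz; rewrite wreflK.
have := ell_word s; rewrite -/l' => b.
have r : rise i (wrefl i l') by apply: ell_lt_rise; rewrite wreflK; lia.
rewrite r IHs //; by have := ell_rise r; rewrite wreflK; lia.
Qed.

Lemma plen_le s : (plen (word_perm s) <= size s)%N.
Proof.
elim: s => [|i s IHs] /=.
  rewrite leqn0 cards_eq0; apply/eqP/setP=> -[c d]; rewrite !inE /= !perm1; lia.
set w := word_perm s in IHs *.
have [lt|lt|e] := ltngtP ((w^-1)%g (rhi i)) ((w^-1)%g (rlo i)).
- by have := plen_refl lt; lia.
- rewrite (@plen_refl _ (w * refl i)%g i).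
    by rewrite -mulgA /refl tperm2 mulg1 ltnS.
  by rewrite invMg tpermV !permM tpermL tpermR.
by move/val_inj/perm_inj: e => e; have := lo_neq_hi i; rewrite e eqxx.
Qed.

Lemma actw_climb s l : climb s l -> actw (word_perm s) (w0 n k) = l.
Proof.
elim: s l => [|i s IHs] l /=.
  by move=> /eqP ->; apply/ffunP=> p; rewrite [LHS]ffunE invg1 perm1.
case/andP=> _ /IHs e; apply/ffunP=> p.
rewrite ffunE invMg permM tpermV.
by have /ffunP/(_ (refl i p)) := e; rewrite !ffunE tpermK.
Qed.

Lemma Gamma_ones (l : Gamma n k) : ones (val l) = k.
Proof. exact/eqP/(valP l). Qed.

(** A climb u to l has the least size that [ell_word] permits, so the minimal
    permutation is no longer than u and its reduced word is again a climb. *)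
Lemma wmin_climb (l : Gamma n k) : climb (reduced_word (wmin l)) (val l).
Proof.
have [u cu] := ex_climb (Gamma_ones l).
have Pu : actw (word_perm u) (w0 n k) == val l by apply/eqP/actw_climb.
have [Pw min_w] : actw (wmin l) (w0 n k) = val l /\
    (plen (wmin l) <= plen (word_perm u))%N.
  (* The identity need not lead to l, so the minimum is compared with the one
     that starts from the permutation of u. *)
  rewrite /wmin /arg_min /extremum; case: pickP => [w|none].
    by case/andP=> /eqP -> /forallP/(_ (word_perm u))/implyP/(_ Pu).
  have := none (arg_min (word_perm u) (fun w => actw w (w0 n k) == val l) (@plen n)).
  case: arg_minnP => // w Pw wmin /=.
  by rewrite Pw; case/negP; apply/forallP=> v; apply/implyP/wmin.
have /andP[/eqP ww /eqP sw] : reduced (wmin l) (reduced_word (wmin l)) by apply: xchooseP.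
apply: short_climb; first by rewrite ww.
by rewrite sw; have := climb_size cu; have := plen_le u; lia.
Qed.

End Climb.

(** * Words as lists of letters *)
Section Values.
Variables (K : fieldType) (q Q : K).

Lemma nth_swap_at T (x0 : T) i s j : (i.+1 < size s)%N ->
  nth x0 (swap_at i s) j = nth x0 s (if j == i then i.+1 else if j == i.+1 then i else j).
Proof.
elim: i s j => [|i IHi] [|x [|z s]] // [|j] // lt_i.
  by case: j => [|j].
rewrite /= -/(swap_at i (z :: s)) IHi // !eqSS.
by case: (j == i) => //; case: (j == i.+1).
Qed.

Lemma at_pos_Rop (T : eqType) (x0 : T) st sw i (F : seq T -> K) s :
  (i.+1 < size s)%N ->
  let x := nth x0 s i in let y := nth x0 s i.+1 in
  at_pos (Rop st sw) i F s
  = if x == y then F s else st x y * F s + sw x y * F (swap_at i s).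
Proof.
elim: i s F => [|i IHi] [|x [|y s]] F //= lt_i; exact: (IHi (y :: s)).
Qed.

Lemma at_pos_letter (op : _ -> label -> label -> K) w i F (s : seq bool) :
  (forall F x z, op F (letter x) (letter z)
     = Rb q Q w (fun a b => F (letter a) (letter b)) x z) ->
  at_pos op i F (map letter s) = at_pos (Rb q Q w) i (fun s => F (map letter s)) s.
Proof.
move=> e; elim: i s F => [|i IHi] [|x [|z s]] F //=.
- exact: (IHi [::]).
- exact: (IHi (z :: s)).
Qed.

Lemma nth_values n T (x0 : T) (f : 'I_n -> T) (a : 'I_n) : nth x0 (values f) a = f a.
Proof.
by rewrite (nth_map a) ?size_enum_ord // nth_ord_enum.
Qed.

Lemma values_refl n T (f : 'I_n -> T) (i : 'I_n.-1) :
  values (fun a => f (refl i a)) = swap_at i (values f).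
Proof.
have n0 : (i.+1 < n)%N := ltn_ord (rhi i).
have x0 := f (rhi i).
apply: (@eq_from_nth _ x0) => [|j]; first by rewrite size_swap_at !size_values.
rewrite size_values => ltj; rewrite -[j]/(nat_of_ord (Ordinal ltj)).
rewrite nth_swap_at ?size_values // nth_values reflE -!val_eqE /=.
case: eqP => _; first by rewrite -[i.+1]/(nat_of_ord (rhi i)) nth_values.
case: eqP => _; first by rewrite -[nat_of_ord i]/(nat_of_ord (rlo i)) nth_values.
by rewrite -[j in RHS]/(nat_of_ord (Ordinal ltj)) nth_values.
Qed.

Lemma values_letter n (l : word n) : values (fun a => letter (l a)) = map letter (values l).
Proof. by rewrite /values -map_comp. Qed.

Lemma values_wrefl n (l : word n) i : values (wrefl i l) = swap_at i (values l).
Proof. by rewrite -values_refl; apply: eq_values => a; rewrite ffunE. Qed.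

Lemma values_inj n (l m : word n) : values l = values m -> l = m.
Proof.
by move=> e; apply/ffunP=> a; rewrite -(nth_values false l) e nth_values.
Qed.

Lemma sorted_bools (s : seq bool) : sorted implb s ->
  s = nseq (size s - count id s) false ++ nseq (count id s) true.
Proof.
elim: s => // x s IHs /= xs.
have {}IHs := IHs (path_sorted xs).
have le_s : (count id s <= size s)%N := count_size _ _.
case: x xs => /= xs; last by rewrite add0n subSn //= -IHs.
have all1 : all id s.
  have tr : transitive implb by move=> [] [] [].
  by have := order_path_min tr xs; apply: sub_all => -[].
have := all1; rewrite all_count => /eqP cs.
have e := count_nseq_true (erefl (size s)) cs.
by rewrite add1n cs subnn /= -e.
Qed.

End Values.

Lemma count_values n (l : word n) : count id (values l) = ones l.
Proof.
rewrite /ones -sum1_card -sum1_count /values big_map big_enum_cond.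
by apply: eq_bigl => a; rewrite inE.
Qed.

(** * Segre classes over a field with reflections *)
Section Hecke.
Variables (K : fieldType) (n k : nat) (q Q : K) (y : 'I_n -> K).
(* The action of the simple reflections on the scalars. *)
Variable s : 'I_n.-1 -> {rmorphism K -> K}.
Hypothesis y0 : forall a, y a != 0.
Hypothesis q0 : q != 0.
Hypothesis yE : forall a b : 'I_n, a != b -> y a != y b.
Hypothesis yden : forall a b : 'I_n, a != b -> den q Q (y a / y b) != 0.
Hypothesis sq : forall i, s i q = q.
Hypothesis sQ : forall i, s i Q = Q.
Hypothesis sy : forall i a, s i (y a) = y (refl i a).
Hypothesis sK : forall i, involutive (s i).
Hypothesis s_comm : forall (i j : 'I_n.-1) z,
  (i.+1 < j)%N -> s i (s j z) = s j (s i z).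
Hypothesis s_braid : forall (i j : 'I_n.-1) z,
  i.+1 = j :> nat -> s i (s j (s i z)) = s j (s i (s j z)).

Hypothesis k_le : (k <= n)%N.

Implicit Types (i j : 'I_n.-1) (l m : word n) (f g : word n -> K).

Definition coefA (u v : K) := (Q - q ^+ 2) / (1 - (u / v)^-1).
Definition coefB (u v : K) := (Q - q ^+ 2 * (u / v)) / (1 - u / v).

Lemma s_coefA i u v : s i (coefA u v) = coefA (s i u) (s i v).
Proof. by rewrite /coefA !(fmorph_div, rmorphB, fmorphV, rmorphXn, rmorph1, sq, sQ). Qed.
Lemma s_coefB i u v : s i (coefB u v) = coefB (s i u) (s i v).
Proof. by rewrite /coefB fmorph_div !rmorphB rmorphM rmorphXn fmorph_div rmorph1 sq sQ. Qed.

(** The operator d_i.  As r_i m has as many letters 1 as m, it may be taken on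
    functions of all words at once. *)
Definition DL i f m : K :=
  coefA (y (rlo i)) (y (rhi i)) * f m
  + coefB (y (rlo i)) (y (rhi i)) * s i (f (wrefl i m)).

Lemma DL_ext i f g : f =1 g -> DL i f =1 DL i g.
Proof. by move=> e m; rewrite /DL !e. Qed.

Lemma DLQ i f : DL i (fun m => Q * f m) =1 (fun m => Q * DL i f m).
Proof. by move=> m; rewrite /DL rmorphM sQ; ring. Qed.

Lemma DL_comm i j f m : (i.+1 < j)%N -> DL i (DL j f) m = DL j (DL i f) m.
Proof.
move=> ij.
have [|e1 e2 e3 e4] := @far_neq _ i j; first by rewrite ij.
rewrite /DL !(rmorphD, rmorphM, s_coefA, s_coefB, sy) (s_comm _ ij) (wrefl_comm _ ij).
rewrite !(refl_fix (i := i) (a := rlo j)) // !(refl_fix (i := i) (a := rhi j)) //.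
rewrite !(refl_fix (i := j) (a := rlo i)) 1?eq_sym //.
rewrite !(refl_fix (i := j) (a := rhi i)) 1?eq_sym //.
ring.
Qed.

(** Both sides are combinations of the six transforms of f under the group
    generated by r_i and r_j; the coefficients are compared in the parameters
    of the three letters involved. *)
Lemma DL_braid i j f m : i.+1 = j :> nat ->
  DL i (DL j (DL i f)) m = DL j (DL i (DL j f)) m.
Proof.
move=> ij.
have [e n2 n1] := adj_neq ij.
have n3 : rlo j != rhi j by apply: lo_neq_hi.
have [rlo_i rlo_j rhi_j] := refl_adj_l ij.
have [r1 r2 r3] := refl_adj_r ij.
have rb := wrefl_braid m ij.
rewrite /DL e !(rmorphD, rmorphM, s_coefA, s_coefB, sy,
  rlo_j, rlo_i, rhi_j, r1, r2, r3, wreflK, sK).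
rewrite rb (s_braid _ ij).
have h1 := yE n1; have h2 := yE n2; have h3 := yE n3.
move: (y0 (rlo i)) (y0 (rlo j)) (y0 (rhi j)) h1 h2 h3.
move: (y (rlo i)) (y (rlo j)) (y (rhi j)) => a b c a0 b0 c0 ac ab bc.
have coefAE u v : u != 0 -> v != 0 -> u != v -> coefA u v = (Q - q ^+ 2) * u / (u - v).
  move=> u0 v0 uv; rewrite /coefA; field.
  by rewrite v0 u0 subr_eq0 uv.
have coefBE u v : v != 0 -> u != v -> coefB u v = (Q * v - q ^+ 2 * u) / (v - u).
  move=> v0 uv; rewrite /coefB; field.
  by rewrite v0 subr_eq0 eq_sym uv.
rewrite !coefAE ?coefBE // 1?eq_sym //.
field.
by rewrite !subr_eq0 ab bc ac !(eq_sym _ a) ?(eq_sym c) ab ac bc.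
Qed.

Definition inv_factor (p : 'I_n * 'I_n) : K :=
  (1 - (y p.1 / y p.2)^-1) / (Q - q ^+ 2 * (y p.1 / y p.2)^-1).

(** The restriction of S_l to the fixed point l; see [segre_diag]. *)
Definition inv_prod l : K := \prod_(p | isinv l p) inv_factor p.

Lemma s_inv_factor i p : s i (inv_factor p) = inv_factor (refl2 i p).
Proof.
rewrite /inv_factor fmorph_div !rmorphB rmorphM rmorphXn fmorphV fmorph_div rmorph1.
by rewrite sq sQ !sy.
Qed.

Lemma s_inv_prod_same i l : l (rlo i) = l (rhi i) -> s i (inv_prod l) = inv_prod l.
Proof.
move=> e; rewrite /inv_prod rmorph_prod; under eq_bigr => p _ do rewrite s_inv_factor.
rewrite (reindex_inj (inv_inj (refl2K i))) /=.
by apply: eq_big => p; rewrite ?refl2K // isinv_wrefl_same.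
Qed.

Lemma s_inv_prod_rise i l : rise i l ->
  s i (inv_prod (wrefl i l)) = inv_factor (rhi i, rlo i) * inv_prod l.
Proof.
case/andP=> l0 l1; rewrite /inv_prod rmorph_prod.
under eq_bigr => p _ do rewrite s_inv_factor.
exact: (big_isinv _ inv_factor l0 l1).
Qed.

Definition segre_base m : K := if m == w0 n k then inv_prod (w0 n k) else 0.
Definition segre_along (t : seq 'I_n.-1) : word n -> K := foldr DL segre_base t.

(** A word that reads 01 at i, i+1 cannot do so at i+1, i+2. *)
Lemma rise_far i j l : rise i l -> rise j l -> i != j -> (i.+1 < j)%N || (j.+1 < i)%N.
Proof.
case/andP=> i0 i1 /andP[j0 j1].
case: (distP i j) => [->||/adj_neq[e _ _]|/adj_neq[e _ _]] //; first by rewrite eqxx.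
  by rewrite e (negPf j0) in i1.
by rewrite e (negPf i0) in j1.
Qed.

Lemma DL_far i j f m : (i.+1 < j)%N || (j.+1 < i)%N ->
  DL i (DL j f) m = DL j (DL i f) m.
Proof. by case/orP=> ij; [|symmetry]; apply: DL_comm. Qed.

Lemma climb_ones t l : climb k t l -> ones l = ones (w0 n k).
Proof.
elim: t l => [|i t IHt] l /=; first by move/eqP->.
by case/andP=> _ /IHt; rewrite ones_wrefl.
Qed.

Lemma ones_w0 : ones (w0 n k) = k.
Proof.
rewrite -[RHS](card_below k_le) /ones; apply: eq_card => p.
by rewrite !inE ffunE.
Qed.

(** If two climbs to l end with different reflections i and j, these are far
    apart, and a common climb v to r_i r_j l extends to both r_i l and r_j l.
    By induction both classes are d_i d_j of the class along v. *)
Lemma climb_uniq t u l : climb k t l -> climb k u l -> segre_along t =1 segre_along u.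
Proof.
have [d] := ubnP (size t); elim: d t u l => // d IHd [|i t] [|j u] l //= lt_d.
- by move=> /eqP -> /andP[]; rewrite w0_norise.
- by move=> /andP[r _] /eqP e; rewrite e w0_norise in r.
move=> /andP[ri ct] /andP[rj cu].
have [eij|nij] := eqVneq i j.
  by rewrite -eij in cu *; apply: DL_ext; apply: IHd ct cu.
have far := rise_far ri rj nij.
have [f1 f2 f3 f4] := far_neq far.
have rj' : rise j (wrefl i l) by rewrite /rise !wrefl_other.
have ri' : rise i (wrefl j l) by rewrite /rise !wrefl_other // eq_sym.
have [v cv] : exists v, climb k v (wrefl j (wrefl i l)).
  by apply: ex_climb; rewrite !ones_wrefl -ones_w0 -(climb_ones ct) ones_wrefl.
have rc : wrefl j (wrefl i l) = wrefl i (wrefl j l).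
  by case/orP: far => h; rewrite (wrefl_comm _ h).
have ctv : climb k (j :: v) (wrefl i l) by rewrite /= rj'.
have cuv : climb k (i :: v) (wrefl j l) by rewrite /= ri' -rc.
have sz : (size u).+1 = (size t).+1.
  move: (climb_size ct); rewrite -(climb_size cu) !ell_rise //.
  by move=> /addIn ->.
have lt_t : (size t < d)%N by [].
have lt_u : (size u < d)%N by case: sz => ->.
move=> m; rewrite (DL_ext i (IHd _ _ _ lt_t ct ctv)).
rewrite [RHS](DL_ext j (IHd _ _ _ lt_u cu cuv)).
exact: DL_far.
Qed.

Lemma coefAB a b : a != b -> coefA (y a) (y b) + coefB (y a) (y b) = Q.
Proof.
move=> /yE ab; have := y0 a; have := y0 b; rewrite /coefA /coefB.
move: (y a) (y b) ab => u v uv v0 u0; field.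
by rewrite u0 v0 !subr_eq0 uv eq_sym uv.
Qed.

(** By induction along the climb, whose last step is at some j where l reads 01.
    If i and j are far
    apart then d_i and d_j commute.  Otherwise l reads 001 or 011 at the three
    positions involved; then the class is d_j d_i of the class of a word with
    equal letters at j, and the braid relation moves the eigenvalue from d_j
    to d_i. *)
Lemma DL_same t l i : climb k t l -> l (rlo i) = l (rhi i) ->
  DL i (segre_along t) =1 (fun m => Q * segre_along t m).
Proof.
have [d] := ubnP (size t); elim: d t l i => // d IHd [|j t] l i lt_d /=.
  move=> /eqP -> e m; rewrite /DL /segre_along /= /segre_base.
  have -> : (wrefl i m == w0 n k) = (m == w0 n k).
    by rewrite -{1}(wrefl_id e) (inj_eq (inv_inj (wreflK i))).
  case: ifP => _; last by rewrite rmorph0 !mulr0 addr0.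
  by rewrite s_inv_prod_same // -mulrDl coefAB // lo_neq_hi.
move=> /andP[rj ct] e.
have lt_t : (size t < d)%N by [].
have [j_0 j_1] := andP rj.
have ex_v : exists v, climb k v (wrefl i (wrefl j l)).
  by apply: ex_climb; rewrite !ones_wrefl -ones_w0 -(climb_ones ct) ones_wrefl.
case: (distP i j) => [ij|far|ij|ji].
- by move: e j_0; rewrite ij j_1 => ->.
- have [f1 f2 f3 f4] := far_neq far.
  move=> m; rewrite DL_far // (DL_ext j (IHd _ _ i lt_t ct _)) ?DLQ //.
  by rewrite !wrefl_other // eq_sym.
- (* l reads 001 *)
  have [eh n1 n2] := adj_neq ij.
  have ri' : rise i (wrefl j l).
    by rewrite /rise eh wrefl_lo j_1 andbT wrefl_other ?e ?eh.
  have [v cv] := ex_v.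
  have ctv : climb k (i :: v) (wrefl j l) by rewrite /= ri'.
  have sz : (size v < d)%N by rewrite (climb_size_eq ct ctv) in lt_t; apply: ltnW.
  have eqt := climb_uniq ct ctv.
  have same_j : DL j (segre_along v) =1 (fun m => Q * segre_along v m).
    apply: (IHd _ _ j sz cv).
    rewrite -eh wrefl_hi [RHS]wrefl_other ?eh 1?[rhi j == _]eq_sym //; last exact: lo_neq_hi.
    by rewrite wrefl_hi wrefl_other ?e ?eh.
  move=> m; rewrite (DL_ext i (DL_ext j eqt)) /= DL_braid //.
  rewrite [in RHS](DL_ext j eqt) /= -DLQ; apply: DL_ext => {}m.
  by rewrite -DLQ; apply: DL_ext.
(* l reads 011 *)
have [eh n1 n2] := adj_neq ji.
have nhi : rhi i != rhi j by rewrite eh eq_sym lo_neq_hi.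
have ri' : rise i (wrefl j l).
  rewrite /rise -eh wrefl_hi j_0 wrefl_other 1?[rhi i == rlo j]eq_sym //.
  by rewrite -e -eh.
have [v cv] := ex_v.
have ctv : climb k (i :: v) (wrefl j l) by rewrite /= ri'.
have sz : (size v < d)%N by rewrite (climb_size_eq ct ctv) in lt_t; apply: ltnW.
have eqt := climb_uniq ct ctv.
have same_j : DL j (segre_along v) =1 (fun m => Q * segre_along v m).
  apply: (IHd _ _ j sz cv).
  by rewrite wrefl_other // wrefl_lo eh wrefl_lo [RHS]wrefl_other 1?[rhi i == rlo j]eq_sym //.
move=> m; rewrite (DL_ext i (DL_ext j eqt)) /= -DL_braid //.
rewrite [in RHS](DL_ext j eqt) /= -DLQ; apply: DL_ext => {}m.
by rewrite -DLQ; apply: DL_ext.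
Qed.

(** Applying d_i can enlarge the support by r_i only, and r_i lowers [ell] by at
    most one. *)
Lemma segre_support t l m : climb k t l -> (ell m < ell l)%N -> segre_along t m = 0.
Proof.
elim: t l m => [|i t IHt] l m /=.
  move=> /eqP -> lt; rewrite /segre_along /= /segre_base; case: eqP => // e.
  by rewrite e ltnn in lt.
case/andP=> r ct lt; rewrite /DL !(IHt _ _ ct); last 2 first.
- by rewrite (ell_rise r); apply: leq_ltn_trans (ell_wrefl_le i m) _; rewrite ltnS.
- by rewrite (ell_rise r) ltnS ltnW.
by rewrite rmorph0 !mulr0 addr0.
Qed.

(** By [segre_support] only the second term of d_i contributes at l, and its
    coefficient cancels the factor of the inversion that r_i removes. *)
Lemma segre_diag t l : climb k t l -> segre_along t l = inv_prod l.
Proof.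
elim: t l => [|i t IHt] l /=; first by move/eqP ->; rewrite /segre_along /= /segre_base eqxx.
case/andP=> r ct; rewrite /DL (IHt _ ct) (segre_support ct); last by rewrite ell_rise.
rewrite mulr0 add0r s_inv_prod_rise // mulrA /coefB /inv_factor /= invf_div.
have ne := yE (lo_neq_hi i); have := yden (lo_neq_hi i); rewrite /den.
move: (y0 (rlo i)) (y0 (rhi i)) ne; move: (y (rlo i)) (y (rhi i)) => u v u0 v0 uv d.
have d' : Q * v - q ^+ 2 * u != 0.
  have -> : Q * v - q ^+ 2 * u = v * (Q - q ^+ 2 * (u / v)) by field.
  by rewrite mulf_neq0.
by field; rewrite v0 d' subr_eq0 eq_sym uv.
Qed.

(** * The product rule at a fixed point *)

(* The classes along any chosen climbs. *)
Variable S : Gamma n k -> word n -> K.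
Hypothesis S_climb : forall l : Gamma n k, exists2 t,
  climb k t (val l) & S l =1 segre_along t.

Definition reflG i (l : Gamma n k) : Gamma n k := actG (refl i) l.
Lemma val_reflG i (l : Gamma n k) : val (reflG i l) = wrefl i (val l).
Proof. exact: wrefl_actw. Qed.
Lemma reflGK i : involutive (reflG i).
Proof. by move=> l; apply: val_inj; rewrite !val_reflG wreflK. Qed.

Lemma S_rise i (l : Gamma n k) : rise i (val l) -> S l =1 DL i (S (reflG i l)).
Proof.
move=> r p; have [t ct ->] := S_climb l; have [v cv Sv] := S_climb (reflG i l).
rewrite (DL_ext i Sv).
have cl : climb k (i :: v) (val l) by rewrite /= r -val_reflG.
exact: (climb_uniq ct cl).
Qed.

Lemma S_same i (l : Gamma n k) : val l (rlo i) = val l (rhi i) ->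
  DL i (S l) =1 (fun p => Q * S l p).
Proof.
move=> e p; have [t ct St] := S_climb l.
rewrite (DL_ext i St) St.
exact: (DL_same ct e).
Qed.

Lemma DL_quad i f p :
  DL i (DL i f) p = (Q - q ^+ 2) * DL i f p + q ^+ 2 * Q * f p.
Proof.
rewrite /DL !(rmorphD, rmorphM, s_coefA, s_coefB, sy, wreflK, sK) // /refl tpermL tpermR.
have := yE (lo_neq_hi i); have := y0 (rlo i); have := y0 (rhi i).
move: (y (rlo i)) (y (rhi i)) => a b b0 a0 ab; rewrite /coefA /coefB; field.
by rewrite a0 b0 !subr_eq0 ab eq_sym ab.
Qed.

(** [Rb] at position i, acting on functions of words; [RgammaT] is its
    transpose. *)
Definition Rgamma w i (F : Gamma n k -> K) (l : Gamma n k) : K :=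
  if val l (rlo i) == val l (rhi i) then F l
  else stay q Q rank_h w (letter (val l (rlo i))) (letter (val l (rhi i))) * F l
     + swap q Q w (letter (val l (rlo i))) (letter (val l (rhi i))) * F (reflG i l).

Definition RgammaT w i (F : Gamma n k -> K) (l : Gamma n k) : K :=
  if val l (rlo i) == val l (rhi i) then F l
  else stay q Q rank_h w (letter (val l (rlo i))) (letter (val l (rhi i))) * F l
     + swap q Q w (letter (val l (rhi i))) (letter (val l (rlo i))) * F (reflG i l).

Definition qS (l : Gamma n k) p : K := q ^+ ell (val l) * S l p.
Definition ratio i := y (rhi i) / y (rlo i).

(** d_i S_l is known in terms of S_l and S_{r_i l} in each of the cases 00, 11,
    10 and 01; solving its definition for the value at r_i p and applying r_i
    gives the R-matrix with parameter e^{y_{i+1} - y_i}.  The powers of q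
    make it agree with [Rb]. *)
Lemma qS_wrefl i (l : Gamma n k) p :
  qS l (wrefl i p) = Rgamma (ratio i) i (fun l' : Gamma n k => s i (qS l' p)) l.
Proof.
pose a := y (rlo i); pose b := y (rhi i).
have a0 : a != 0 := y0 _; have b0 : b != 0 := y0 _.
have ab : a != b := yE (lo_neq_hi i).
have E1 : den q Q (b / a) != 0 by apply: yden; rewrite eq_sym lo_neq_hi.
have dE : Q * a - q ^+ 2 * b != 0.
  have -> : Q * a - q ^+ 2 * b = a * (Q - q ^+ 2 * (b / a)) by field.
  by rewrite mulf_neq0.
have eqn c : DL i (S l) p = c ->
    S l (wrefl i p) = (s i c - coefA b a * s i (S l p)) / coefB b a.
  move=> <-; rewrite /DL !(rmorphD, rmorphM, s_coefA, s_coefB, sy, sK) //.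
  rewrite /refl tpermL tpermR -/a -/b /coefA /coefB; field.
  by rewrite a0 b0 dE !subr_eq0 ab eq_sym ab.
rewrite /qS /Rgamma rmorphM rmorphXn sq /stay /swap /ratio -/a -/b.
rewrite (rmorphM (s i)) (rmorphXn (s i)) sq.
case lo: (val l (rlo i)); case hi: (val l (rhi i)) => /=.
- rewrite (eqn _ (S_same (etrans lo (esym hi)) p)) rmorphM sQ /coefA /coefB.
  by field; rewrite a0 b0 dE !subr_eq0 ab eq_sym ab.
- have r : rise i (val (reflG i l)) by rewrite val_reflG rise_wrefl lo hi.
  have -> : ell (val l) = (ell (val (reflG i l))).+1.
    by rewrite -(ell_rise r) val_reflG wreflK.
  rewrite [q ^+ (ell _).+1]exprS.
  have e := S_rise r p; rewrite reflGK in e.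
  rewrite (eqn _ (esym e)) /coefA /coefB /den.
  by field; rewrite a0 b0 dE !subr_eq0 ab eq_sym ab.
- have r : rise i (val l) by rewrite /rise lo hi.
  have -> : ell (val (reflG i l)) = (ell (val l)).+1.
    by rewrite val_reflG ell_rise.
  rewrite [q ^+ (ell _).+1]exprS.
  have e : DL i (S l) p = (Q - q ^+ 2) * S l p + q ^+ 2 * Q * S (reflG i l) p.
    rewrite (DL_ext i (S_rise r)) DL_quad; congr (_ * _ + _).
    by rewrite (S_rise r).
  have sc : s i (Q - q ^+ 2) = Q - q ^+ 2 by rewrite rmorphB rmorphXn sq sQ.
  have sc2 : s i (q ^+ 2 * Q) = q ^+ 2 * Q by rewrite rmorphM rmorphXn sq sQ.
  rewrite (eqn _ e) rmorphD (rmorphM _ (Q - _)) sc (rmorphM _ (_ * Q)) sc2 /coefA /coefB /den.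
  by field; rewrite a0 b0 dE !subr_eq0 ab eq_sym ab.
rewrite (eqn _ (S_same (etrans lo (esym hi)) p)) rmorphM sQ /coefA /coefB.
by field; rewrite a0 b0 dE !subr_eq0 ab eq_sym ab.
Qed.

Definition puzzle_coef (l m u : Gamma n k) : K :=
  puzzle_sum q Q (values y) (map letter (values (val l)))
    (map letter (values (val m))) (values (val u)).

Lemma generic_values : generic q Q (values y).
Proof.
apply/andP; split; first by apply/allP => _ /mapP[a _ ->].
rewrite /values pairwise_map; apply: (@sub_pairwise _ (fun a b => a != b)) => [a b ab /=|].
  by rewrite !yden // eq_sym.
by rewrite -uniq_pairwise enum_uniq.
Qed.

(** r_i acts on puzzle sums by interchanging two of the parameters y. *)
Lemma puzzle_coef_intertwine i (l m u : Gamma n k) :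
  Rgamma (ratio i) i (fun l' : Gamma n k =>
    Rgamma (ratio i) i (fun m' : Gamma n k => s i (puzzle_coef l' m' u)) m) l
  = RgammaT (ratio i) i (fun u' => puzzle_coef l m u') u.
Proof.
have lt_in : (i.+1 < n)%N := ltn_ord (rhi i).
have nlo (p : word n) : nth false (values p) i = p (rlo i) := nth_values _ _ (rlo i).
have nhi (p : word n) : nth false (values p) i.+1 = p (rhi i) := nth_values _ _ (rhi i).
have RgammaE F (p : Gamma n k) : at_pos (Rb q Q (ratio i)) i F (values (val p))
    = Rgamma (ratio i) i (fun p' => F (values (val p'))) p.
  by rewrite (at_pos_Rop false) ?size_values // nlo nhi /Rgamma val_reflG values_wrefl.
have -> : RgammaT (ratio i) i (fun u' => puzzle_coef l m u') u
    = at_pos (RbT q Q (ratio i)) i (fun v => puzzle_sum q Q (values y)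
        (map letter (values (val l))) (map letter (values (val m))) v) (values (val u)).
  by rewrite (at_pos_Rop false) ?size_values // nlo nhi /RgammaT /puzzle_coef val_reflG values_wrefl.
have -> : ratio i = nth 0 (values y) i.+1 / nth 0 (values y) i.
  by rewrite (nth_values 0 y (rhi i)) (nth_values 0 y (rlo i)).
have lt_s : (i.+1 < size (values y))%N by rewrite size_values.
have sz (p : Gamma n k) : size (map letter (values (val p))) = size (values y).
  by rewrite size_map !size_values.
have sz_u : size (values (val u)) = size (values y) by rewrite !size_values.
rewrite -(puzzle_sum_intertwine q0 generic_values (sz l) (sz m) sz_u lt_s).
rewrite (nth_values 0 y (rhi i)) (nth_values 0 y (rlo i)) -/(ratio i).
rewrite (at_pos_letter _ _ _ (@Rg_letter _ q Q (ratio i))) RgammaE.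
rewrite /Rgamma; have H (l' : Gamma n k) :
  (if val m (rlo i) == val m (rhi i) then s i (puzzle_coef l' m u)
   else stay q Q rank_h (ratio i) (letter (val m (rlo i))) (letter (val m (rhi i)))
          * s i (puzzle_coef l' m u)
        + swap q Q (ratio i) (letter (val m (rlo i))) (letter (val m (rhi i)))
          * s i (puzzle_coef l' (reflG i m) u))
   = at_pos (Rh q Q (ratio i)) i (fun hs => puzzle_sum q Q (swap_at i (values y))
       (map letter (values (val l'))) hs (values (val u)))
      (map letter (values (val m))).
  rewrite (at_pos_letter _ _ _ (@Rh_letter _ q Q (ratio i))) RgammaE /Rgamma /puzzle_coef.
  have sy' : [seq s i z | z <- values y] = swap_at i (values y).
    by rewrite -values_refl /values -map_comp; apply: eq_map => a /=; rewrite sy.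
  by rewrite !puzzle_sum_morph sq sQ sy'.
by rewrite !H.
Qed.

Lemma Rgamma_ext w i F G (l : Gamma n k) : F =1 G -> Rgamma w i F l = Rgamma w i G l.
Proof. by move=> e; rewrite /Rgamma !e. Qed.

Lemma Rgamma_mulr w i F c (l : Gamma n k) :
  Rgamma w i F l * c = Rgamma w i (fun p => F p * c) l.
Proof. by rewrite /Rgamma; case: ifP => // _; rewrite mulrDl !mulrA. Qed.

Lemma Rgamma_mull w i F c (l : Gamma n k) :
  c * Rgamma w i F l = Rgamma w i (fun p => c * F p) l.
Proof. by rewrite mulrC Rgamma_mulr; apply: Rgamma_ext => p; rewrite mulrC. Qed.

Lemma Rgamma_sum w i (F : Gamma n k -> Gamma n k -> K) (l : Gamma n k) :
  Rgamma w i (fun p => \sum_u F u p) l = \sum_u Rgamma w i (F u) l.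
Proof.
rewrite /Rgamma; case: ifP => // _.
by rewrite !mulr_sumr -big_split.
Qed.

Lemma RgammaT_adj w i F G : \sum_u RgammaT w i F u * G u = \sum_u F u * Rgamma w i G u.
Proof.
pose C (u : Gamma n k) := if val u (rlo i) == val u (rhi i) then 1
  else stay q Q rank_h w (letter (val u (rlo i))) (letter (val u (rhi i))).
pose D (u : Gamma n k) := if val u (rlo i) == val u (rhi i) then 0
  else swap q Q w (letter (val u (rlo i))) (letter (val u (rhi i))).
have RgammaE H u : Rgamma w i H u = C u * H u + D u * H (reflG i u).
  by rewrite /Rgamma /C /D; case: ifP => // _; rewrite mul1r mul0r addr0.
have RgammaTE H u : RgammaT w i H u = C u * H u + D (reflG i u) * H (reflG i u).
  rewrite /RgammaT /C /D val_reflG wrefl_lo wrefl_hi eq_sym.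
  by case: ifP => // _; rewrite mul1r mul0r addr0.
under eq_bigr => u _ do rewrite RgammaTE mulrDl.
under [RHS]eq_bigr => u _ do rewrite RgammaE mulrDr.
rewrite !big_split /=; congr (_ + _).
  by apply: eq_bigr => u _; rewrite mulrCA mulrA.
rewrite (reindex_inj (inv_inj (reflGK i))) /=.
by apply: eq_bigr => u _; rewrite reflGK mulrCA mulrA.
Qed.

Lemma ell0_values (l : Gamma n k) : ell (val l) = 0%N ->
  values (val l) = nseq (n - k) false ++ nseq k true.
Proof.
move=> l0.
have mono (a b : 'I_n) : (a <= b)%N -> val l a -> val l b.
  apply: no_drop_monotone => i; apply/negP=> r.
  by have := ell_rise r; rewrite wreflK l0.
rewrite [LHS]sorted_bools ?size_values ?count_values ?Gamma_ones //.
apply/(sortedP false) => a; rewrite size_values => lt_a.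
rewrite -[a]/(nat_of_ord (Ordinal (ltnW lt_a))) nth_values.
rewrite -[a.+1]/(nat_of_ord (Ordinal lt_a)) nth_values.
by apply/implyP/mono.
Qed.

(** Induction on the number of inversions of the fixed point p.  If p has none,
    it is sorted.  Otherwise p = r_i p' with fewer inversions in p', and the
    R-matrices that act on l and m are moved through the puzzle sums onto the
    index u of the class on the right. *)
Theorem product_rule (p : Gamma n k) : forall l m : Gamma n k,
  qS l (val p) * qS m (val p) = \sum_u puzzle_coef l m u * qS u (val p).
Proof.
have [d] := ubnP (ell (val p)); elim: d p => // d IHd p lt_d l m.
have [p0|] := posnP (ell (val p)).
  have qSE (u : Gamma n k) : qS u (val p) = (u == p)%:R.
    rewrite /qS; have [->|ne] := eqVneq u p.
      have [t ct ->] := S_climb p.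
      rewrite p0 mul1r (segre_diag ct) /inv_prod big_pred0 // => x.
      apply/negP=> inv_x; move/eqP: p0; rewrite ellE sum_nat_eq0.
      by move=> /forallP/(_ x)/implyP/(_ inv_x).
    have [t ct ->] := S_climb u.
    rewrite (segre_support ct) ?mulr0 // p0 lt0n; apply: contra ne => /eqP u0.
    by apply/eqP/val_inj/values_inj; rewrite !ell0_values.
  rewrite (bigD1 p) //= big1 => [|u /negPf nu]; last by rewrite qSE nu mulr0.
  rewrite addr0 !qSE eqxx mulr1 /puzzle_coef (ell0_values p0).
  rewrite puzzle_sum_top ?size_values ?subnK // ?count_values ?Gamma_ones //.
  rewrite -(ell0_values p0) -natrM mulnb; congr (_%:R).
  have valuesE (u : Gamma n k) : (values (val u) == values (val p)) = (u == p).
    by apply/eqP/eqP=> [/values_inj/val_inj|->].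
  by rewrite !valuesE.
move=> /ell_gt0[i r].
pose p' := reflG i p.
have pE : val p = wrefl i (val p') by rewrite val_reflG wreflK.
have IH := IHd p' _.
have lt' : (ell (val p') < d)%N.
  by move: lt_d (ell_rise r); rewrite /p' val_reflG wreflK => + e; rewrite e ltnS.
rewrite pE !qS_wrefl Rgamma_mulr.
transitivity (Rgamma (ratio i) i (fun l' : Gamma n k => Rgamma (ratio i) i (fun m' : Gamma n k =>
   \sum_u s i (puzzle_coef l' m' u) * s i (qS u (val p'))) m) l).
  apply: Rgamma_ext => l'; rewrite Rgamma_mull; apply: Rgamma_ext => m'.
  rewrite -rmorphM IH // rmorph_sum; apply: eq_bigr => u _; exact: rmorphM.
transitivity (\sum_u RgammaT (ratio i) i (fun u' => puzzle_coef l m u') u * s i (qS u (val p'))).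
  under Rgamma_ext => l' do rewrite Rgamma_sum.
  rewrite Rgamma_sum; apply: eq_bigr => u _; rewrite -puzzle_coef_intertwine Rgamma_mulr.
  by apply: Rgamma_ext => l'; rewrite Rgamma_mulr.
rewrite RgammaT_adj; apply: eq_bigr => u _.
by rewrite qS_wrefl.
Qed.

End Hecke.

(** * Permutations acting on the fraction field *)
Section FracMap.
Variables (R : idomainType) (f : {rmorphism R -> R}).
Hypothesis f_inj : injective f.

Lemma frac_ind (P : {fraction R} -> Prop) :
  (forall a b, b != 0 -> P (tofrac a / tofrac b)) -> forall x, P x.
Proof. by move=> H x; rewrite (frac_numden x); apply: H; exact: denom_ratioP. Qed.

Let f0 b : b != 0 -> tofrac (f b) != 0 :> {fraction R}.
Proof.
move=> b0; rewrite tofrac_eq0; apply: contra b0 => /eqP e.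
by apply/eqP/f_inj; rewrite e rmorph0.
Qed.

Let t0 (b : R) : b != 0 -> tofrac b != 0.
Proof. by rewrite tofrac_eq0. Qed.

Lemma frac_mapD : {morph frac_map f : x y / x + y}.
Proof.
elim/frac_ind => a b b0; elim/frac_ind => c d d0.
rewrite addf_div ?t0 // -!tofracM -tofracD !frac_map_frac ?mulf_neq0 //.
by rewrite !rmorphD !rmorphM addf_div ?f0.
Qed.

Lemma frac_mapM : {morph frac_map f : x y / x * y}.
Proof.
elim/frac_ind => a b b0; elim/frac_ind => c d d0.
rewrite mulf_div -!tofracM !frac_map_frac ?mulf_neq0 //.
by rewrite !rmorphM mulf_div.
Qed.

Lemma frac_map_tofrac a : frac_map f (tofrac a) = tofrac (f a).
Proof.
rewrite -[tofrac a]divr1 -tofrac1 frac_map_frac ?oner_neq0 //.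
by rewrite rmorph1 tofrac1 divr1.
Qed.

Lemma frac_map_is_zmod_morphism : zmod_morphism (frac_map f).
Proof.
move=> x y; apply: (addIr (frac_map f y)); rewrite -frac_mapD !subrK //.
Qed.

Lemma frac_map_is_monoid_morphism : monoid_morphism (frac_map f).
Proof.
by split; [rewrite -tofrac1 frac_map_tofrac rmorph1 | exact: frac_mapM].
Qed.

End FracMap.

Lemma frac_map_comp (R : idomainType) (f g h : {rmorphism R -> R}) x :
  injective f -> injective g -> (forall p, h p = f (g p)) ->
  frac_map f (frac_map g x) = frac_map h x.
Proof.
move=> f_inj g_inj hE.
have h_inj : injective h by move=> p r; rewrite !hE => /f_inj/g_inj.
elim/frac_ind: x => a b b0.
have gb0 : g b != 0 by rewrite -(rmorph0 g) (inj_eq g_inj).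
by rewrite !frac_map_frac // !hE.
Qed.

Lemma frac_map_id (R : idomainType) (f : {rmorphism R -> R}) x :
  (forall p, f p = p) -> frac_map f x = x.
Proof.
move=> fE; have f_inj : injective f by move=> p r; rewrite !fE.
by elim/frac_ind: x => a b b0; rewrite frac_map_frac // !fE.
Qed.

Lemma rmorph_Q (R S : nzRingType) (f : {rmorphism R -> S}) (q b : R) :
  f (q ^+ 2 + b - q ^+ 2 * b) = f q ^+ 2 + f b - f q ^+ 2 * f b.
Proof. by rewrite rmorphB rmorphD (rmorphM f (q ^+ 2)) rmorphXn. Qed.

Section ActF.
Variable n : nat.
Implicit Types (w : 'S_n).

HB.instance Definition _ w := GRing.isZmodMorphism.Build (FracB n) (FracB n) (@actF n w)
  (@frac_map_is_zmod_morphism _ (msym w) (@inj_msym _ _ w)).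
HB.instance Definition _ w := GRing.isMonoidMorphism.Build (FracB n) (FracB n) (@actF n w)
  (@frac_map_is_monoid_morphism _ (msym w) (@inj_msym _ _ w)).

Lemma actF_ofB w a : actF w (ofB a) = ofB (msym w a).
Proof. exact: (@frac_map_tofrac _ (msym w) (@inj_msym _ _ w)). Qed.

Lemma actF_comp w1 w2 x : actF w1 (actF w2 x) = actF (w2 * w1)%g x.
Proof.
apply: (@frac_map_comp _ (msym w1) (msym w2) (msym (w2 * w1)%g)).
- exact: inj_msym.
- exact: inj_msym.
- by move=> p; exact: msymMm.
Qed.

Lemma actF1 x : actF (1%g : 'S_n) x = x.
Proof. by apply: (@frac_map_id _ (msym (1%g : 'S_n))) => p; exact: msym1m. Qed.

Lemma msymC w (c : {poly {poly int}}) : msym w c%:MP_[n] = c%:MP.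
Proof. by rewrite -[c%:MP]mulr1 mul_mpolyC msymZ msym1. Qed.

Lemma actF_qq w : actF w (qq n) = qq n.
Proof. by rewrite /qq actF_ofB msymC. Qed.

Lemma actF_bb w : actF w (bb n) = bb n.
Proof. by rewrite /bb actF_ofB msymC. Qed.

Lemma actF_QQ w : actF w (QQ n) = QQ n.
Proof.
pose Qof (q b : FracB n) := q ^+ 2 + b - q ^+ 2 * b.
exact: etrans (rmorph_Q (actF w) _ _) (f_equal2 Qof (actF_qq w) (actF_bb w)).
Qed.

Lemma actF_ey w a : actF w (ey a) = ey (w a).
Proof.
rewrite /ey actF_ofB msymX; congr (ofB 'X_[_]); apply/mnmP=> b.
rewrite mnmE !mnm1E; congr (nat_of_bool _).
by apply/eqP/eqP=> [->|<-]; rewrite ?permKV ?permK.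
Qed.

Lemma ofB_neq0 (p : Bpol n) : p != 0 -> ofB p != 0.
Proof. by rewrite /ofB tofrac_eq0. Qed.

Lemma qq_neq0 : qq n != 0.
Proof. by apply: ofB_neq0; rewrite mpolyC_eq0 polyC_eq0 polyX_eq0. Qed.

(** The coefficient of X_a is p. *)
Lemma ey_coef_neq0 (p r : {poly {poly int}}) (a b : 'I_n) : a != b -> p != 0 ->
  ofB (p%:MP * 'X_a - r%:MP * 'X_b) != 0.
Proof.
move=> ab p0; apply: ofB_neq0; apply/eqP => /(congr1 (mcoeff U_(a)%MM)).
rewrite mcoeff0 mcoeffB !mcoeffCM !mcoeffXU eqxx eq_sym (negPf ab).
by rewrite mulr1 mulr0 subr0 => /eqP; rewrite (negPf p0).
Qed.

Lemma ey_neq0 (a : 'I_n) : ey a != 0.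
Proof.
apply: ofB_neq0; apply/eqP => /(congr1 (mcoeff U_(a)%MM)) /eqP.
by rewrite mcoeff0 mcoeffXU eqxx oner_eq0.
Qed.

Lemma ey_neq (a b : 'I_n) : a != b -> ey a != ey b.
Proof.
move=> ab; rewrite -subr_eq0 -[X in X - _]mul1r -[X in _ - X]mul1r.
have := @ey_coef_neq0 1 1 a b ab (oner_neq0 _).
by rewrite /ofB rmorphB !rmorphM !rmorph1.
Qed.

(** At beta = 0 the polynomial Q becomes q^2. *)
Lemma Qpoly_neq0 : 'X%:P ^+ 2 + 'X - 'X%:P ^+ 2 * 'X != 0 :> {poly {poly int}}.
Proof.
apply/eqP => /(congr1 (fun p : {poly {poly int}} => p.[0])) /eqP.
by rewrite !hornerE subr0 expf_eq0 polyX_eq0.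
Qed.

Lemma QQ_ofB : QQ n = ofB (('X%:P ^+ 2 + 'X - 'X%:P ^+ 2 * 'X : {poly {poly int}})%:MP).
Proof.
exact: esym (rmorph_Q (@tofrac (Bpol n) \o @mpolyC n _) 'X%:P 'X).
Qed.

Lemma den_neq0 (a b : 'I_n) : a != b -> den (qq n) (QQ n) (ey a / ey b) != 0.
Proof.
rewrite eq_sym => ab.
have := ey_coef_neq0 ('X%:P ^+ 2) ab Qpoly_neq0.
have -> : ofB (('X%:P ^+ 2 + 'X - 'X%:P ^+ 2 * 'X : {poly {poly int}})%:MP * 'X_b
   - ('X%:P ^+ 2 : {poly {poly int}})%:MP * 'X_a) = den (qq n) (QQ n) (ey a / ey b) * ey b.
  rewrite /den mulrBl -(mulrA (qq n ^+ 2)) divfK ?ey_neq0 // QQ_ofB.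
  rewrite /ofB tofracB !tofracM -/(ey _); congr (_ - _ * _).
exact: (rmorphXn (@tofrac (Bpol n) \o @mpolyC n _) 2 'X%:P).
by apply: contra => /eqP ->; apply/eqP/mul0r.
Qed.

End ActF.

(** * The deformed motivic Segre classes *)
Section Final.
Variables (n k : nat).
Definition refl_act (i : 'I_n.-1) : {rmorphism FracB n -> FracB n} := actF (refl i).

Lemma refl_act_sy i a : refl_act i (ey a) = ey (refl i a).
Proof. exact: actF_ey. Qed.

Lemma refl_actK i : involutive (refl_act i).
Proof. by move=> x; rewrite /refl_act /= actF_comp /refl tperm2 actF1. Qed.

Lemma refl_act_comm (i j : 'I_n.-1) x :
  (i.+1 < j)%N -> refl_act i (refl_act j x) = refl_act j (refl_act i x).
Proof.
move=> ij; rewrite /refl_act /= !actF_comp; congr (actF _ x); apply/permP=> a.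
by rewrite !permM (refl_comm _ ij).
Qed.

Lemma refl_act_braid (i j : 'I_n.-1) x : i.+1 = j :> nat ->
  refl_act i (refl_act j (refl_act i x)) = refl_act j (refl_act i (refl_act j x)).
Proof.
move=> ij; rewrite /refl_act /= !actF_comp; congr (actF _ x); apply/permP=> a.
by rewrite !permM (refl_braid _ ij).
Qed.

Definition segre_at (l : Gamma n k) : word n -> FracB n :=
  segre_along k (qq n) (QQ n) (@ey n) refl_act (reduced_word (wmin l)).

Lemma Segre_at l (m : Gamma n k) : Segre l m = segre_at l (val m).
Proof.
rewrite /Segre /partial_perm /segre_at /segre_along; elim: (reduced_word _) m => [|i t IHt] m /=.
  rewrite ffunE /segre_base; case: ifP => // _; rewrite /inv_prod /inv_factor.
  by apply: eq_bigl => p; rewrite isinv_w0.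
rewrite ffunE /DL !IHt bb_QQ val_reflG.
reflexivity.
Qed.

End Final.

Lemma locclassM n k (f g : locclass n k) p : (f * g) p = f p * g p.
Proof. by rewrite ffunE. Qed.

Lemma locclassZ n k (a : FracB n) (f : locclass n k) p : (a *: f) p = a * f p.
Proof. by rewrite ffunE. Qed.

Theorem theorem5p6 (n k : nat) (hk : (1 <= k <= n - 1)%N) (l m : Gamma n k) :
  ((qq n ^+ ell (val l)) *: Segre l) * ((qq n ^+ ell (val m)) *: Segre m)
  = \sum_(u : Gamma n k)
      (\sum_(P : labelling n | is_puzzle (val l) (val m) (val u) P) fug P)
        *: ((qq n ^+ ell (val u)) *: Segre u).
Proof.
have k_le : (k <= n)%N by case/andP: hk => _ /leq_trans; apply; exact: leq_subr.
have segre_at_climb (p : Gamma n k) : exists2 t, climb k t (val p) &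
    segre_at p =1 segre_along k (qq n) (QQ n) (@ey n) (@refl_act n) t.
  by exists (reduced_word (wmin p)); first exact: wmin_climb.
have rule := product_rule (@ey_neq0 n) (qq_neq0 n) (@ey_neq n) (@den_neq0 n)
  (fun i => actF_qq (refl i)) (fun i => actF_QQ (refl i)) (@refl_act_sy n) (@refl_actK n)
  (@refl_act_comm n) (@refl_act_braid n) k_le segre_at_climb.
have SegreE (v p : Gamma n k) : ((qq n ^+ ell (val v)) *: Segre v) p
    = qS (qq n) (@segre_at n k) v (val p) by rewrite locclassZ Segre_at.
apply/ffunP=> p; apply: (etrans (locclassM _ _ p)).
apply: (etrans (congr2 *%R (SegreE l p) (SegreE m p))).
apply: (etrans (rule p l m)); apply/esym; apply: (etrans (sum_ffunE _ _ _ _)).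
apply: eq_bigr => u _; apply/esym.
by rewrite locclassZ (SegreE u) sum_fug labelling_sumE !values_letter.
Qed.
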